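(* Let $A\subseteq C$ be a unital irreducible inclusion of $C^*$-algebras (that is, $A'\cap C=\mathbb C1$) with a faithful conditional expectation $E:C\to A$ of finite Watatani index. Then the Watatani index $\mathrm{Ind}(E)$ is scalar, and the number of $E$-compatible intermediate unital $C^*$-algebras $A\subseteq B\subseteq C$ is at most $$2^{\dim_{\mathbb C}(A'\cap C_1)-1}\le 2^{\lfloor\|\mathrm{Ind}(E)\|\rfloor-1}<2^{\|\mathrm{Ind}(E)\|},$$ where $C_1$ is the basic construction. Neither $A$ nor $C$ is required to be simple.
   Context: $C^*$-algebras are nonzero, and intermediate algebras contain the common unit. Finite Watatani index means that $E$ admits a finite quasi-basis: elements $u_i,v_i\in C$ ($1\le i\le n$) with $x=\sum_i u_iE(v_ix)=\sum_i E(xu_i)v_i$ for all $x\in C$; then $\mathrm{Ind}(E)=\sum_i u_iv_i$, a positive invertible central element of $C$. Equip $C$, as a right $A$-module $C_A$, with the $A$-valued inner product $\langle x,y\rangle_A=E(x^*y)$; let $e_A$ be the adjointable operator $c\mapsto E(c)$ on $C_A$ and $L_x$ left multiplication by $x\in C$. The basic construction $C_1$ is the $C^*$-algebra of adjointable operators on $C_A$ spanned by the operators $L_xe_AL_{y}$, $x,y\in C$ (under finite Watatani index it equals the algebra of all adjointable operators on $C_A$); $A\subseteq C$ is viewed inside $C_1$ by left multiplication. An intermediate unital $C^*$-algebra $B$ is $E$-compatible if there is a conditional expectation $F_B:C\to B$ with $E=(E|_B)\circ F_B$; both endpoints $A$ and $C$ are included. *)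

(* Defs.v *)
From HB Require Import structures.
From mathcomp Require Import all_boot all_order all_algebra.
From mathcomp Require Import complex.
From mathcomp Require Import all_classical all_reals all_analysis.
Set Implicit Arguments. Unset Strict Implicit. Unset Printing Implicit Defensive.
Import Order.TTheory GRing.Theory Num.Theory.
Local Open Scope classical_set_scope.
Local Open Scope ring_scope.

(* Unital C*-algebras over R[i]; nonzero, because 1 != 0 in every nzRingType.
   The norm is a field of the mixin, with values in R, because the existing
   class hierarchy has no join of normed modules and (noncommutative) rings
   other than Num.NumDomain.  The complex modulus `|c| has type R[i]; its real
   part is the modulus as an element of R. *)
HB.mixin Record isCStarAlgebra (R : realType) C of GRing.Algebra R[i] C := {
  star : C -> C ;
  cnorm : C -> R ;
  starK : forall x : C, star (star x) = x ;
  starD : forall x y : C, star (x + y) = star x + star y ;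
  starZ : forall (c : R[i]) (x : C), star (c *: x) = Num.conj c *: star x ;
  starM : forall x y : C, star (x * y) = star y * star x ;
  cnorm_eq0 : forall x : C, cnorm x = 0 -> x = 0 ;
  cnormD : forall x y : C, cnorm (x + y) <= cnorm x + cnorm y ;
  cnormZ : forall (c : R[i]) (x : C), cnorm (c *: x) = complex.Re `|c| * cnorm x ;
  cnormM : forall x y : C, cnorm (x * y) <= cnorm x * cnorm y ;
  cnorm_starM : forall x : C, cnorm (star x * x) = cnorm x ^+ 2 ;
  cnorm_complete : forall u : nat -> C,
    (forall eps : R, 0 < eps -> exists n0 : nat, forall m n : nat,
       (n0 <= m)%N -> (n0 <= n)%N -> cnorm (u m - u n) < eps) ->
    exists l : C, forall eps : R, 0 < eps -> exists n0 : nat, forall n : nat,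
       (n0 <= n)%N -> cnorm (u n - l) < eps
}.

#[short(type="cstarAlgType")]
HB.structure Definition CStarAlgebra (R : realType) :=
  {C of isCStarAlgebra R C & GRing.Algebra R[i] C}.

Section LinearAlgebra.
Variables (K : fieldType) (V : lmodType K).

Definition lin_span (S : set V) : set V :=
  [set v | exists (n : nat) (c : 'I_n -> K) (w : 'I_n -> V),
     (forall i, S (w i)) /\ v = \sum_(i < n) c i *: w i].

Definition has_dim (S : set V) (d : nat) : Prop :=
  exists b : 'I_d -> V,
    [/\ forall c : 'I_d -> K, \sum_(i < d) c i *: b i = 0 -> forall i, c i = 0
      & lin_span (range b) = S].

End LinearAlgebra.

Section WatataniIndex.
Variables (R : realType) (C : cstarAlgType R).
Implicit Types (A B : set C) (E F : C -> C).

Definition cstar_subalgebra A : Prop :=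
  [/\ A 1,
      forall (c : R[i]) x y, A x -> A y -> A (c *: x + y),
      forall x y, A x -> A y -> A (x * y),
      forall x, A x -> A (star x)
    & forall x, (forall eps : R, 0 < eps -> exists2 a, A a & cnorm (x - a) < eps) ->
      A x].

Definition commutant A : set C := [set x | forall a, A a -> a * x = x * a].

Definition irreducible A : Prop :=
  commutant A = [set x | exists c : R[i], x = c *: 1].

Definition cpositive (x : C) : Prop := exists y : C, x = star y * y.

Definition conditional_expectation A E : Prop :=
  [/\ forall (c : R[i]) x y, E (c *: x + y) = c *: E x + E y,
      forall x, A (E x),
      forall a, A a -> E a = a,
      forall a x b, A a -> A b -> E (a * x * b) = a * E x * b
    & forall x, cpositive x -> cpositive (E x)].

Definition faithful E : Prop := forall x, E (star x * x) = 0 -> x = 0.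

Definition quasi_basis E n (u v : 'I_n -> C) : Prop :=
  forall x, x = \sum_(i < n) u i * E (v i * x) /\
            x = \sum_(i < n) E (x * u i) * v i.

Definition finite_watatani_index E : Prop :=
  exists n (u v : 'I_n -> C), quasi_basis E u v.

(* The value does not depend on the quasi-basis; it is the default 0 if there
   is none. *)
Definition Ind E : C :=
  xget 0 [set z | exists n (u v : 'I_n -> C),
            quasi_basis E u v /\ z = \sum_(i < n) u i * v i].

Definition lmul (x : C) : C -> C := fun y => x * y.

Definition inner E (x y : C) : C := E (star x * y).

Definition module_norm E (x : C) : R := Num.sqrt (cnorm (inner E x x)).

Definition adjointable E (T : C -> C) : Prop :=
  exists T' : C -> C, forall x y, inner E (T x) y = inner E x (T' y).

(* The middle factor E is the operator e_A; the span is closed in the operator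
   norm of C_A (under finite Watatani index it is already closed). *)
Definition basic_construction E : set (C -> C) :=
  [set T | adjointable E T /\
     forall eps : R, 0 < eps ->
     exists2 S : C -> C,
       lin_span [set W | exists x y : C, W = lmul x \o E \o lmul y] S
       & forall z, module_norm E (T z - S z) <= eps * module_norm E z].

Definition commutant_in_basic_construction A E : set (C -> C) :=
  [set T | basic_construction E T /\
           forall a, A a -> lmul a \o T = T \o lmul a].

Definition compatible A E B : Prop :=
  [/\ cstar_subalgebra B, A `<=` B
    & exists F, conditional_expectation B F /\ forall x, E x = E (F x)].

End WatataniIndex.

(* Main.v *)
Require Import Defs.
From mathcomp Require Import all_boot all_order all_algebra.
From mathcomp Require Import complex.
From mathcomp Require Import all_classical all_reals all_analysis.
From mathcomp Require Import finmap ring lra.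
Set Implicit Arguments. Unset Strict Implicit. Unset Printing Implicit Defensive.
Import Order.TTheory GRing.Theory Num.Theory.
Local Open Scope classical_set_scope.
Local Open Scope card_scope.
Local Open Scope ring_scope.

(** The proof replaces operators by the space M of bimodule maps of C over A, that
is, linear maps commuting with left and right multiplication by A.  A conditional
expectation of finite index has a self-adjoint quasi-basis w_r, star w_r
(exists_quasi_basis_star); with it, M is exactly the commutant of A in the basic
construction (commutant_basic_construction).  Every sum of f (w_r, star w_r)
with f balanced over A and A-bilinear commutes with A, hence is a scalar by
irreducibility (casimir_scalar).  This is the only use of irreducibility, and it
is used many times: it makes Ind E scalar, and it gives M a scalar product
(S, T) = sum_r S w_r * star (T w_r) and a trace.

Dimension.  If T_j is an orthonormal family in M, Bessel's inequality in the
row space of C reads sum_j star (T_j x) * T_j x <= E (star x * x).  Summing it over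
x = star w_r gives sum_j |bar T_j|^2 <= Ind E, where
bar T x = star (T (star x)).
Since bar is an antilinear involution, its matrix L in an orthonormal basis
satisfies conj L * L = 1, so the dimension d is the trace of conj L * L and is at
most the sum of the |L_jl|^2, which is the left side above
(orthonormal_basis_card).

Counting.  A compatible B is the range of an expectation F through which E
factors, and F is a point of M solving the quadratic equations F o F = F and
F * F = (tr F) F, with * the convolution.  One coordinate, that along E, is
always 1, so there are d - 1 unknowns.  These solutions are nondegenerate
(expectation_rigid): a tangent vector at F is, on B, an A-linear derivation
into C / B, and such a derivation is inner because the quasi-basis of B over A
is a separability element; irreducibility kills the inner ones.  By a Bezout
bound proved here for nondegenerate zeros of any number of quadrics
(bezout_quadrics) there are at most 2^(d - 1) of them.

All inequalities take place in the positive cone of an abstract C*-algebra.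
The two facts about it that are needed, square roots of positive elements and
positivity of star y * y (psd_sqrt and psd_starM), are obtained without spectral
theory. *)

(** * Identities in noncommutative rings *)

Inductive ncexpr :=
  NcVar of nat | NcZero | NcOne | NcAdd of ncexpr & ncexpr | NcOpp of ncexpr
| NcMul of ncexpr & ncexpr.

Fixpoint nc_eval (D : pzRingType) (env : seq D) (e : ncexpr) : D :=
  match e with
  | NcVar i => nth 0 env i
  | NcZero => 0
  | NcOne => 1
  | NcAdd f g => nc_eval env f + nc_eval env g
  | NcOpp f => - nc_eval env f
  | NcMul f g => nc_eval env f * nc_eval env g
  end.

Fixpoint nc_words (e : ncexpr) : seq (bool * seq nat) :=
  match e with
  | NcVar i => [:: (false, [:: i])]
  | NcZero => [::]
  | NcOne => [:: (false, [::])]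
  | NcAdd f g => nc_words f ++ nc_words g
  | NcOpp f => [seq (~~ p.1, p.2) | p <- nc_words f]
  | NcMul f g =>
    flatten [seq [seq (p.1 (+) r.1, p.2 ++ r.2) | r <- nc_words g] | p <- nc_words f]
  end.

Definition nc_term (D : pzRingType) (env : seq D) (p : bool * seq nat) : D :=
  (-1) ^+ p.1 * \prod_(i <- p.2) nth 0 env i.

Lemma nc_wordsE (D : pzRingType) (env : seq D) e :
  nc_eval env e = \sum_(p <- nc_words e) nc_term env p.
Proof.
elim: e => [i|||f IHf g IHg|f IHf|f IHf g IHg] /=.
- by rewrite big_seq1 /nc_term big_seq1 mul1r.
- by rewrite big_nil.
- by rewrite big_seq1 /nc_term big_nil mul1r.
- by rewrite big_cat IHf IHg.
- rewrite big_map IHf -sumrN; apply: eq_bigr => p _.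
  by rewrite /nc_term signrN mulNr.
- rewrite IHf IHg big_flatten big_map mulr_suml; apply: eq_bigr => p _.
  rewrite big_map mulr_sumr; apply: eq_bigr => r _.
  rewrite /nc_term signr_addb big_cat /= !mulrA; congr (_ * _).
  by rewrite -!mulrA; congr (_ * _); exact: commr_sign.
Qed.

Fixpoint nc_cancel (l : seq (bool * seq nat)) : seq (bool * seq nat) :=
  if l is p :: l' then
    let m := nc_cancel l' in
    let o := (~~ p.1, p.2) in if o \in m then rem o m else p :: m
  else [::].

Lemma nc_cancelE (D : pzRingType) (env : seq D) l :
  \sum_(p <- nc_cancel l) nc_term env p = \sum_(p <- l) nc_term env p.
Proof.
elim: l => //= p l IHl; rewrite big_cons -IHl; case: ifP => [om | _]; last by rewrite big_cons.
rewrite [in RHS](big_rem _ om) /= addrA -[LHS]add0r; congr (_ + _).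
by rewrite /nc_term /= signrN mulNr addrN.
Qed.

Lemma nc_correct (D : pzRingType) (env : seq D) e f :
  nilp (nc_cancel (nc_words (NcAdd e (NcOpp f)))) -> nc_eval env e = nc_eval env f.
Proof.
move=> /nilP n0; apply/eqP; rewrite -subr_eq0; apply/eqP.
by rewrite -[LHS]/(nc_eval env (NcAdd e (NcOpp f))) nc_wordsE -nc_cancelE n0 big_nil.
Qed.

Ltac nc_index x env :=
  lazymatch env with
  | cons x _ => constr:(0%N)
  | cons _ ?l => let i := nc_index x l in constr:(S i)
  end.

Ltac nc_insert x env :=
  match env with
  | context [cons x _] => env
  | _ => constr:(cons x env)
  end.

Ltac nc_env t env :=
  lazymatch t with
  | (?a + ?b)%R => let env := nc_env a env in nc_env b env
  | (- ?a)%R => nc_env a env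
  | (?a * ?b)%R => let env := nc_env a env in nc_env b env
  | 0%R => env
  | 1%R => env
  | _ => nc_insert t env
  end.

Ltac nc_reify t env :=
  lazymatch t with
  | (?a + ?b)%R => let a := nc_reify a env in let b := nc_reify b env in constr:(NcAdd a b)
  | (- ?a)%R => let a := nc_reify a env in constr:(NcOpp a)
  | (?a * ?b)%R => let a := nc_reify a env in let b := nc_reify b env in constr:(NcMul a b)
  | 0%R => constr:(NcZero)
  | 1%R => constr:(NcOne)
  | _ => let i := nc_index t env in constr:(NcVar i)
  end.

(** Expands both sides into signed words in their atoms and cancels opposite
words.  Atoms are compared syntactically, so a scalar multiple is one atom. *)
Ltac ncring :=
  lazymatch goal with
  | |- @eq ?T ?l ?r =>
    let env := nc_env l (@nil T) in let env := nc_env r env in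
    let e := nc_reify l env in let f := nc_reify r env in
    refine (@nc_correct _ env e f _); vm_compute; reflexivity
  end.

(** * Nondegenerate common zeros of quadrics *)

(** A general L works: on a line L0 + s L1 each determinant is a polynomial in s
that is not zero, and finitely many nonzero polynomials have a common nonroot in
an infinite field. *)
Lemma row_free_unit_common (K : numFieldType) (n m N : nat) (J : 'I_N -> 'M[K]_(n, m)) :
  (forall j, row_free (J j)) -> exists L : 'M[K]_(m, n), forall j, J j *m L \in unitmx.
Proof.
elim: N J => [|N IHN] J Jfree; first by exists 0 => -[].
have [L0 L0P] := IHN (fun j => J (lift ord0 j)) (fun j => Jfree _).
have /row_freeP[L1 L1P] := Jfree ord0.
pose pj j := \det (map_mx polyC (J j *m L0) + 'X *: map_mx polyC (J j *m L1)).
have pjE j (s : K) : (pj j).[s] = \det (J j *m (L0 + s *: L1)).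
  rewrite -horner_evalE -det_map_mx; congr (\det _).
  rewrite mulmxDr -scalemxAr; set X := J j *m L0; set Y := J j *m L1.
  apply/matrixP => a b; rewrite !mxE /= /horner_eval.
  by rewrite hornerD hornerC hornerM hornerX hornerC.
have pj_neq0 j : pj j != 0.
  have [->|[k ->]] : j = ord0 \/ exists k, j = lift ord0 k.
    by case: (unliftP ord0 j) => [k ->|->]; [right; exists k|left].
  (* L1 is a right inverse of the first matrix, so its determinant is a
     characteristic polynomial; the others do not vanish at s = 0. *)
  - have -> : pj ord0 = char_poly (- (J ord0 *m L0)).
      by rewrite /pj L1P map_mx1 scalemx1 /char_poly /char_poly_mx map_mxN opprK addrC.
    exact/monic_neq0/char_poly_monic.
  - apply: contraL (L0P k) => /eqP pk0; rewrite unitmxE unitfE negbK.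
    by rewrite -[L0]addr0 -(scale0r L1) -pjE pk0 horner0.
pose P := \prod_j pj j.
have P_neq0 : P != 0 by apply/prodf_neq0.
have [s Ps] : exists s : K, P.[s] != 0.
  pose rs := [seq i%:R : K | i <- iota 0 (size P)].
  have [/allP rsP|/allPn[s _ sP]] := boolP (all (root P) rs); last by exists s.
  have := max_poly_roots P_neq0 (introT allP rsP).
  rewrite map_inj_uniq ?iota_uniq; last by move=> i j /eqP; rewrite eqr_nat => /eqP.
  by rewrite size_map size_iota ltnn => /(_ isT).
exists (L0 + s *: L1) => j; rewrite unitmxE unitfE -pjE.
by move: Ps; rewrite horner_prod => /prodf_neq0; exact.
Qed.

(** Gaussian elimination without division: each row is replaced by a combination
with a pivot row that cancels the first column. *)
Lemma left_kernel_idomain (D : idomainType) (p N : nat) (A : 'I_N -> 'I_p -> D) :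
  (p < N)%N ->
  exists2 c : 'I_N -> D, exists j, c j != 0 & forall k, \sum_j c j * A j k = 0.
Proof.
elim: p N A => [|p IHp] N A ltpN.
  exists (fun=> 1); last by case.
  by exists (Ordinal ltpN); rewrite oner_neq0.
case: N A ltpN => // N A ltpN.
have [A0|] := altP (@forallP _ (fun j => A j ord0 == 0)).
  have [c c_neq0 cA] := IHp N.+1 (fun j k => A j (lift ord0 k)) (ltnW ltpN).
  exists c => // k; case: (unliftP ord0 k) => [l ->|->]; first exact: cA.
  by rewrite big1 // => j _; rewrite (eqP (A0 j)) mulr0.
rewrite negb_forall => /existsP[r Ar].
have [c [i ci] cA] := IHp N (fun j k => A r ord0 * A (lift r j) (lift ord0 k)
   - A (lift r j) ord0 * A r (lift ord0 k)) ltpN.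
pose c' j := if unlift r j is Some l then A r ord0 * c l
  else - \sum_l c l * A (lift r l) ord0.
have c'r : c' r = - \sum_l c l * A (lift r l) ord0 by rewrite /c' unlift_none.
have c'l l : c' (lift r l) = A r ord0 * c l by rewrite /c' liftK.
exists c'; first by exists (lift r i); rewrite c'l mulf_neq0.
move=> k; rewrite (bigD1_ord r) //= c'r.
under eq_bigr do rewrite c'l.
rewrite mulNr mulr_suml addrC; apply/eqP; rewrite subr_eq0; apply/eqP.
case: (unliftP ord0 k) => [l ->|->]; last first.
  by apply: eq_bigr => j _; rewrite -!mulrA mulrC -mulrA.
apply/eqP; rewrite -subr_eq0 -sumrB -[X in _ == X](cA l); apply/eqP.
apply: eq_bigr => j _.
by rewrite mulrBr [A r ord0 * c j]mulrC !mulrA.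
Qed.

(** Dividing by the common power of 'X makes the relation survive at 'X = 0. *)
Lemma left_kernel_poly (K : fieldType) (p N : nat) (A : 'I_N -> 'I_p -> {poly K}) :
  (p < N)%N ->
  exists2 c : 'I_N -> {poly K}, exists j, (c j).[0] != 0
    & forall k, \sum_j c j * A j k = 0.
Proof.
move=> /(left_kernel_idomain A)[c [i ci] cA].
move: {2}(size (c i)) (leqnn (size (c i))) => s; elim: s c ci cA => [|s IHs] c ci cA les.
  by move: ci; rewrite -size_poly_gt0 ltnNge les.
have [c0|] := altP (@forallP _ (fun j => (c j).[0] == 0)); last first.
  by rewrite negb_forall => /existsP[j cj]; exists c => //; exists j.
have cX j : c j = c j %/ 'X * 'X.
  by rewrite divpK // -[X in X %| _]subr0 dvdp_XsubCl /root c0.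
apply: (IHs (fun j => c j %/ 'X)) => [|k|].
- by apply: contraNneq ci => q0; rewrite (cX i) q0 mul0r.
- apply: (mulIf (negbT (polyX_eq0 K))); rewrite mul0r mulr_suml -[RHS](cA k).
  by apply: eq_bigr => j _; rewrite [in RHS]cX mulrAC.
- by rewrite size_divp ?polyX_eq0 // size_polyX subn1 -ltnS prednK // size_poly_gt0.
Qed.

(** Quadrics in n affine variables are homogenised: the variables have the
indices lift ord0 i, and points are normalised to have coordinate 1 at ord0. *)
Definition bilin (D : comNzRingType) n (q : 'M[D]_n) (x y : 'I_n -> D) : D :=
  \sum_a \sum_b q a b * (x a * y b).

Lemma bilinDl (D : comNzRingType) n (q : 'M[D]_n) (x x' y : 'I_n -> D) :
  bilin q (fun a => x a + x' a) y = bilin q x y + bilin q x' y.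
Proof.
rewrite /bilin -big_split; apply: eq_bigr => a _; rewrite -big_split.
by apply: eq_bigr => b _; rewrite mulrDl mulrDr.
Qed.

Lemma bilinDr (D : comNzRingType) n (q : 'M[D]_n) (x y y' : 'I_n -> D) :
  bilin q x (fun a => y a + y' a) = bilin q x y + bilin q x y'.
Proof.
rewrite /bilin -big_split; apply: eq_bigr => a _; rewrite -big_split.
by apply: eq_bigr => b _; rewrite !mulrDr.
Qed.

Lemma bilinZl (D : comNzRingType) n (q : 'M[D]_n) c (x y : 'I_n -> D) :
  bilin q (fun a => c * x a) y = c * bilin q x y.
Proof.
rewrite /bilin mulr_sumr; apply: eq_bigr => a _; rewrite mulr_sumr.
by apply: eq_bigr => b _; rewrite -!mulrA mulrCA.
Qed.

Lemma bilinZr (D : comNzRingType) n (q : 'M[D]_n) c (x y : 'I_n -> D) :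
  bilin q x (fun a => c * y a) = c * bilin q x y.
Proof.
rewrite /bilin mulr_sumr; apply: eq_bigr => a _; rewrite mulr_sumr.
by apply: eq_bigr => b _; rewrite [c * (_ * _)]mulrCA [c * (_ * y b)]mulrCA.
Qed.

Lemma rmorph_bilin (D D' : comNzRingType) (f : {rmorphism D -> D'}) n (q : 'M[D]_n) x y :
  f (bilin q x y) = bilin (map_mx f q) (f \o x) (f \o y).
Proof.
rewrite rmorph_sum; apply: eq_bigr => a _; rewrite rmorph_sum.
by apply: eq_bigr => b _; rewrite !rmorphM mxE.
Qed.

Lemma eq_bilin (D : comNzRingType) n (q : 'M[D]_n) x x' y y' :
  x =1 x' -> y =1 y' -> bilin q x y = bilin q x' y'.
Proof.
by move=> xx yy; apply: eq_bigr => a _; apply: eq_bigr => b _; rewrite xx yy.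
Qed.

Lemma bilin_suml (D : comNzRingType) n m (q : 'M[D]_n) (c : 'I_m -> D)
    (x : 'I_m -> 'I_n -> D) y :
  bilin q (fun a => \sum_l c l * x l a) y = \sum_l c l * bilin q (x l) y.
Proof.
under [RHS]eq_bigr do rewrite -bilinZl /bilin.
rewrite exchange_big; apply: eq_bigr => a _ /=.
rewrite exchange_big; apply: eq_bigr => b _ /=.
by rewrite -mulr_sumr -mulr_suml.
Qed.

Lemma bilin_sumr (D : comNzRingType) n m (q : 'M[D]_n) (c : 'I_m -> D) x
    (y : 'I_m -> 'I_n -> D) :
  bilin q x (fun a => \sum_l c l * y l a) = \sum_l c l * bilin q x (y l).
Proof.
under [RHS]eq_bigr do rewrite -bilinZr /bilin.
rewrite exchange_big; apply: eq_bigr => a _ /=.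
rewrite exchange_big; apply: eq_bigr => b _ /=.
by rewrite -!mulr_sumr.
Qed.

Definition bvec (D : comNzRingType) n (l : 'I_n) : 'I_n.+1 -> D :=
  fun a => (a == lift ord0 l)%:R.

Lemma bvec_sum (D : comNzRingType) n (v : 'I_n.+1 -> D) :
  v ord0 = 0 -> v =1 (fun a => \sum_l v (lift ord0 l) * bvec D l a).
Proof.
move=> v0 a; case: (unliftP ord0 a) => [k ->|->].
  rewrite (bigD1 k) //= big1 ?addr0 /bvec ?eqxx ?mulr1 // => l /negPf lk.
  by rewrite (inj_eq lift_inj) eq_sym lk mulr0.
by rewrite big1 // => l _; rewrite /bvec (negPf (neq_lift _ _)) mulr0.
Qed.

Definition jacobian (D : comNzRingType) n m (q : 'I_m -> 'M[D]_n.+1) a : 'M[D]_(n, m) :=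
  \matrix_(k, i) (bilin (q i) a (bvec D k) + bilin (q i) (bvec D k) a).

Lemma jacobianE (D : comNzRingType) n m (q : 'I_m -> 'M[D]_n.+1) a (v : 'I_n.+1 -> D) i :
  v ord0 = 0 -> bilin (q i) a v + bilin (q i) v a =
  ((\row_k v (lift ord0 k)) *m jacobian q a) ord0 i.
Proof.
move=> v0; rewrite mxE.
rewrite (eq_bilin _ (frefl a) (bvec_sum v0)) bilin_sumr.
rewrite (eq_bilin _ (bvec_sum v0) (frefl a)) bilin_suml -big_split.
by apply: eq_bigr => l _; rewrite !mxE mulrDr.
Qed.

Section Lifting.
Variables (K : fieldType) (n : nat) (q : 'I_n -> 'M[K]_n.+1).

(** The deformation q_i + t x_i^2 of the quadrics, with parameter t = 'X.  Over
the field of fractions its leading forms are dominated by the squares x_i^2, so that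
it has no zeros at infinity and its quotient algebra is spanned by the 2^n
squarefree monomials. *)
Definition perturbed (x : 'I_n.+1 -> {poly K}) i : {poly K} :=
  bilin (map_mx polyC (q i)) x x + 'X * x (lift ord0 i) ^+ 2.

(** A nondegenerate zero at t = 0 deforms to any finite order.  The derivative of
t x_i^2 is a multiple of t, so the invertible matrix in each Newton step is the
Jacobian of the undeformed quadrics at a. *)
Lemma newton_lift (a : 'I_n.+1 -> K) M :
  a ord0 = 1 -> (forall i, bilin (q i) a a = 0) -> jacobian q a \in unitmx ->
  exists x : 'I_n.+1 -> {poly K},
    [/\ x ord0 = 1, forall k, (x k).[0] = a k & forall i, 'X^(M.+1) %| perturbed x i].
Proof.
move=> a0 qa Ja.
have dvdX (p : {poly K}) : p.[0] = 0 -> 'X %| p.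
  by move=> p0; rewrite -['X]subr0 dvdp_XsubCl /root p0.
elim: M => [|M [x [x0 xa xP]]].
  exists (fun k => (a k)%:P); split=> [|k|i]; rewrite ?a0 ?hornerC // expr1.
  rewrite /perturbed dvdp_addl ?dvdp_mulr //.
  have -> : bilin (map_mx polyC (q i)) (fun k => (a k)%:P) (fun k => (a k)%:P)
    = (bilin (q i) a a)%:P by rewrite rmorph_bilin.
  by rewrite qa dvdp0.
pose W i := perturbed x i %/ 'X^(M.+1).
have WE i : perturbed x i = W i * 'X^(M.+1) by rewrite divpK.
pose beta := - (\row_i (W i).[0]) *m invmx (jacobian q a).
pose b k := if unlift ord0 k is Some l then beta ord0 l else 0.
have b0 : b ord0 = 0 by rewrite /b unlift_none.
have bl l : b (lift ord0 l) = beta ord0 l by rewrite /b liftK.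
have bJ i : bilin (q i) a b + bilin (q i) b a = - (W i).[0].
  rewrite (jacobianE _ _ _ b0).
  have -> : \row_k b (lift ord0 k) = beta by apply/rowP => l; rewrite mxE bl.
  by rewrite mulmxKV // !mxE.
exists (fun k => x k + 'X^(M.+1) * (b k)%:P); split=> [|k|i].
- by rewrite b0 mulr0 addr0.
- by rewrite !hornerE xa expr0n /= mul0r addr0.
pose bP k := (b k)%:P.
pose Q := map_mx polyC (q i).
have -> : perturbed (fun k => x k + 'X^(M.+1) * (b k)%:P) i = 'X^(M.+1) *
   (W i + (bilin Q x bP + bilin Q bP x) + 'X * (2%:R * x (lift ord0 i) * bP (lift ord0 i)) +
    'X * 'X^M * (bilin Q bP bP + 'X * bP (lift ord0 i) ^+ 2)).
  rewrite {1}/perturbed bilinDl !bilinDr !bilinZl !bilinZr -/Q -/bP.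
  have := WE i; rewrite {1}/perturbed -/Q => /(canRL (addrK _)) ->.
  rewrite exprS.
  rewrite -/(bP (lift ord0 i)).
  move: (bilin Q x bP) (bilin Q bP x) (bilin Q bP bP) (W i) ('X^M) (x _) (bP _) => A B D E F G H.
  by ring.
rewrite [in X in X %| _]exprSr dvdp_mul2l ?expf_neq0 ?polyX_eq0 //.
apply: dvdX; rewrite !hornerD !hornerM hornerX !mul0r !addr0.
have ev0 (y z : 'I_n.+1 -> {poly K}) :
    (bilin Q y z).[0] = bilin (q i) (fun k => (y k).[0]) (fun k => (z k).[0]).
  rewrite -horner_evalE rmorph_bilin; congr bilin.
  by apply/matrixP => k l; rewrite mxE [Q k l]mxE /= /horner_eval hornerC.
rewrite !ev0 /bP.
rewrite (_ : bilin _ _ _ = bilin (q i) a b); last first.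
  by apply: eq_bilin => // k; rewrite hornerC.
rewrite (_ : bilin _ _ (fun k => (x k).[0]) = bilin (q i) b a); last first.
  by apply: eq_bilin => // k; rewrite hornerC.
by rewrite bJ subrr.
Qed.

End Lifting.

Section Bezout.
Variables (K : fieldType) (n : nat) (q : 'I_n -> 'M[K]_n.+1) (N : nat).

Let word := {ffun 'I_N -> 'I_n.+1}.

(** Monomials are written as words of fixed length N, with the letter ord0 of
value 1 as padding; replacing two letters by two letters then stays within words,
and no degrees have to be tracked. *)
Definition word_val (D : comNzRingType) (x : 'I_n.+1 -> D) (w : word) : D := \prod_j x (w j).

Definition repeats (w : word) (p : 'I_N * 'I_N) :=
  [&& p.1 != p.2, w p.1 == w p.2 & w p.1 != ord0].

Definition replace2 (w : word) (p : 'I_N * 'I_N) a b : word :=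
  [ffun j => if j == p.1 then a else if j == p.2 then b else w j].

Lemma word_val_replace2 (D : comNzRingType) (x : 'I_n.+1 -> D) w p a b : p.1 != p.2 ->
  word_val x (replace2 w p a b) =
  x a * x b * \prod_(j | (j != p.1) && (j != p.2)) x (w j).
Proof.
move=> p12; rewrite /word_val (bigD1 p.1) //= (bigD1 p.2) 1?eq_sym //= !ffunE eqxx.
rewrite eq_sym (negPf p12) eqxx -!mulrA; congr (_ * (_ * _)).
by apply: eq_bigr => j /andP[/negPf j1 /negPf j2]; rewrite ffunE j1 j2.
Qed.

(** The relation t x_i^2 = - q_i (x) as a matrix on words: t times a word in which
the letter i occurs twice is a combination of words in which these two
occurrences have been replaced. *)
Definition rewriting (w w' : word) : K :=
  if [pick p | repeats w p] is Some p then
    if unlift ord0 (w p.1) is Some i then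
      - \sum_a \sum_b q i a b * (w' == replace2 w p a b)%:R
    else 0
  else 0.

Lemma rewriting_dvd (x : 'I_n.+1 -> {poly K}) M w p :
  (forall i, 'X^M %| perturbed q x i) -> repeats w p ->
  'X^M %| 'X * word_val x w - \sum_w' (rewriting w w')%:P * word_val x w'.
Proof.
rewrite /rewriting => xM wp; case: pickP => [{wp}p|/(_ p)]; last by rewrite wp.
move=> /and3P[p12 /eqP wp]; case: (unliftP ord0 (w p.1)) => [i wi _|->]; last by rewrite eqxx.
pose r := \prod_(j | (j != p.1) && (j != p.2)) x (w j).
suff -> : 'X * word_val x w - \sum_w' (- \sum_a \sum_b q i a b *
   (w' == replace2 w p a b)%:R)%:P * word_val x w' = r * perturbed q x i.
  by rewrite dvdp_mull.
have -> : \sum_w' (- \sum_a \sum_b q i a b * (w' == replace2 w p a b)%:R)%:P * word_val x w' =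
   - (r * bilin (map_mx polyC (q i)) x x).
  transitivity (- \sum_w' \sum_a \sum_b
     (q i a b)%:P * ((w' == replace2 w p a b)%:R * word_val x w')).
    rewrite -sumrN; apply: eq_bigr => w' _; rewrite polyCN mulNr rmorph_sum mulr_suml.
    congr (- _); apply: eq_bigr => a _; rewrite rmorph_sum mulr_suml.
    by apply: eq_bigr => b _; rewrite rmorphM /= -polyC_natr mulrA.
  congr (- _); rewrite exchange_big mulr_sumr; apply: eq_bigr => a _.
  rewrite exchange_big mulr_sumr; apply: eq_bigr => b _.
  rewrite (bigD1 (replace2 w p a b)) //= eqxx mul1r big1 ?addr0 => [|w' /negPf->].
    by rewrite word_val_replace2 // mxE -/r; ring.
  by rewrite mul0r mulr0.
have -> : word_val x w = word_val x (replace2 w p (w p.1) (w p.2)).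
  congr (word_val x _); apply/ffunP => j; rewrite ffunE.
  by case: eqP => [->|_] //; case: eqP => [->|].
rewrite word_val_replace2 // -wp wi -/r /perturbed; ring.
Qed.

(** A word without repeated affine letters depends only on the set of these
letters; this is where the number 2^n comes from. *)
Lemma word_val_good (D : comNzRingType) (x : 'I_n.+1 -> D) w : x ord0 = 1 ->
  (forall p, ~~ repeats w p) ->
  word_val x w = \prod_(i | lift ord0 i \in [set w j | j in 'I_N]%SET) x (lift ord0 i).
Proof.
move=> x0 good; pose S := [set j | w j != ord0]%SET.
transitivity (\prod_(j in S) x (w j)).
  rewrite /word_val (bigID (mem S)) /= [X in _ * X]big1 ?mulr1 // => j.
  by rewrite inE negbK => /eqP ->.
rewrite -(big_imset x) /=; last first.
  move=> j k; rewrite !inE => wj _ wjk; apply/eqP; apply: contraNT (good (j, k)) => jk.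
  by rewrite /repeats /= jk wjk eqxx -wjk.
rewrite big_mkcond big_ord_recl /=.
case: imsetP => [[j]|_]; first by rewrite inE eq_sym => /eqP.
rewrite mul1r [RHS]big_mkcond; apply: eq_bigr => i _ /=.
congr (if _ then _ else _); apply/imsetP/imsetP => -[j jS wj]; exists j => //.
by rewrite inE -wj eq_sym neq_lift.
Qed.

(** If N > 2^n, the deformed zeros satisfy a nontrivial linear relation on all
squarefree monomials.  Let psi w be the value of that relation on the word w.
The rewriting matrix Q gives ('X - Q) psi = 0 to high order in 'X, hence
char_poly Q * psi = 0 to high order, and since char_poly Q has smaller
degree, psi vanishes at 'X = 0.  So at 'X = 0 the relation holds on all words of
length N, which is absurd: a product of N linear forms separates one zero from
the others. *)
Lemma bezout_square (a : 'I_N -> 'I_n.+1 -> K) :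
  (forall j, a j ord0 = 1) -> (forall j k, a j =1 a k -> j = k) ->
  (forall i j, bilin (q i) (a j) (a j) = 0) ->
  (forall j, jacobian q (a j) \in unitmx) -> (N <= 2 ^ n)%N.
Proof.
move=> a0 a_inj qa Ja; rewrite leqNgt; apply/negP => ltN.
set m := #|{: word}|.
have /fin_all_exists[x xP] : forall j, exists x : 'I_n.+1 -> {poly K},
    [/\ x ord0 = 1, forall k, (x k).[0] = a j k & forall i, 'X^(m.+1) %| perturbed q x i].
  by move=> j; apply: newton_lift.
pose e (j : 'I_N) (k : 'I_#|{set 'I_n}|) := \prod_(i in enum_val k) x j (lift ord0 i).
have [|c [j0 cj0] ce] := left_kernel_poly e.
  by rewrite -cardsT -powersetT card_powerset cardsT card_ord.
pose psi w := \sum_j c j * word_val (x j) w.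
have psi_good w : (forall p, ~~ repeats w p) -> psi w = 0.
  move=> good; rewrite -[RHS](ce (enum_rank [set i | lift ord0 i \in [set w j | j in 'I_N]%SET]%SET)).
  apply: eq_bigr => j _; have [xj0 _ _] := xP j; rewrite (word_val_good xj0 good) /e enum_rankK.
  by congr (_ * _); apply: eq_bigl => i; rewrite inE.
have psiP w : 'X^(m.+1) %| 'X * psi w - \sum_w' (rewriting w w')%:P * psi w'.
  have [p wp|good] := pickP (repeats w); last first.
    rewrite psi_good ?mulr0 => [|p]; last by rewrite good.
    rewrite big1 ?subr0 ?dvdp0 // => w' _; rewrite /rewriting.
    by case: pickP => [p|_]; rewrite ?good // mul0r.
  have -> : 'X * psi w - \sum_w' (rewriting w w')%:P * psi w' = \sum_j c j *
      ('X * word_val (x j) w - \sum_w' (rewriting w w')%:P * word_val (x j) w').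
    rewrite mulr_sumr; under [X in _ - X]eq_bigr do rewrite mulr_sumr.
    rewrite exchange_big -sumrB; apply: eq_bigr => j _ /=.
    rewrite mulrBr mulr_sumr mulrCA; congr (_ - _).
    by apply: eq_bigr => w' _; rewrite mulrCA.
  apply: (big_ind (fun p => 'X^(m.+1) %| p)) => [|p1 p2|j _]; rewrite ?dvdp0 //.
    exact: dvdp_add.
  by rewrite dvdp_mull // (rewriting_dvd _ wp) //; have [] := xP j.
pose Q : 'M[K]_m := \matrix_(k, l) rewriting (enum_val k) (enum_val l).
pose Psi : 'cV[{poly K}]_m := \col_k psi (enum_val k).
have chiP w : 'X^(m.+1) %| char_poly Q * psi w.
  have -> : char_poly Q * psi w = (char_poly Q *: Psi) (enum_rank w) ord0.
    by rewrite !mxE enum_rankK.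
  rewrite -mul_scalar_mx -mul_adj_mx -mulmxA mxE.
  apply: (big_ind (fun p => 'X^(m.+1) %| p)) => [|p1 p2|k _]; rewrite ?dvdp0 //.
    exact: dvdp_add.
  rewrite dvdp_mull // mulmxBl mul_scalar_mx !mxE.
  rewrite (reindex_onto enum_rank enum_val) /= => [|l _]; last exact: enum_valK.
  under eq_bigl do rewrite enum_rankK eqxx.
  under eq_bigr do rewrite !mxE enum_rankK.
  exact: psiP.
have psi0 w : (psi w).[0] = 0.
  apply/eqP; apply: contraT => psiw.
  have := chiP w; rewrite Gauss_dvdpl; last first.
    by rewrite coprimep_expl // coprimep_sym -['X]subr0 coprimep_XsubC /root.
  move/(dvdp_leq (monic_neq0 (char_poly_monic Q))).
  by rewrite size_polyXn size_char_poly ltnn.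
(* The form attached to j0 itself is the coordinate at ord0, which is 1 there. *)
have sep j : exists l : 'I_n.+1 -> K, \sum_k l k * a j0 k != 0 /\
    (j != j0 -> \sum_k l k * a j k = 0).
  have [->|jj0] := eqVneq j j0.
    exists (fun k => (k == ord0)%:R); split=> //.
    by rewrite (bigD1 ord0) //= a0 !mul1r big1 ?addr0 ?oner_neq0 // => k /negPf ->; rewrite mul0r.
  have [/forallP ajj0|] := boolP [forall k, a j k == a j0 k].
    by case/eqP: jj0; apply: a_inj => k; apply/eqP.
  rewrite negb_forall => /existsP[k ajk].
  have lE i : \sum_k0 ((k0 == k)%:R - (k0 == ord0)%:R * a j k) * a i k0 = a i k - a j k.
    under eq_bigr do rewrite mulrBl; rewrite sumrB; congr (_ - _).
      by rewrite (bigD1 k) //= eqxx mul1r big1 ?addr0 // => l /negPf ->; rewrite mul0r.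
    rewrite (bigD1 ord0) //= a0 mul1r mulr1 big1 ?addr0 // => l /negPf ->.
    by rewrite !mul0r.
  exists (fun l => (l == k)%:R - (l == ord0)%:R * a j k).
  by rewrite !lE subrr subr_eq0 eq_sym.
have [l /all_and2[l0 lj]] := fin_all_exists sep.
have : \sum_(w : word) (\prod_i l i (w i)) * (psi w).[0] = (c j0).[0] * \prod_i \sum_k l i k * a j0 k.
  transitivity (\sum_j (c j).[0] * \prod_i \sum_k l i k * a j k).
    under eq_bigr do rewrite /psi -horner_evalE rmorph_sum mulr_sumr.
    rewrite exchange_big; apply: eq_bigr => j _ /=.
    rewrite bigA_distr_bigA mulr_sumr; apply: eq_bigr => w _.
    rewrite rmorphM mulrCA; congr (_ * _); rewrite big_split; congr (_ * _).
    rewrite rmorph_prod; apply: eq_bigr => i _ /=.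
    by have [_ xa _] := xP j; rewrite -xa.
  rewrite (bigD1 j0) //= [X in _ + X]big1 ?addr0 // => j jj0.
  by rewrite (bigD1 j) //= lj // mul0r mulr0.
rewrite big1 => [/esym/eqP|w _]; last by rewrite psi0 mulr0.
by rewrite mulf_eq0 (negPf cj0) prodf_seq_eq0 => /hasP[i _ /=]; rewrite (negPf (l0 i)).
Qed.

End Bezout.

(** With more quadrics than variables, n general linear combinations of them are
still nondegenerate at all the given zeros. *)
Theorem bezout_quadrics (K : numFieldType) (n m N : nat) (q : 'I_m -> 'M[K]_n.+1)
    (a : 'I_N -> 'I_n.+1 -> K) :
  (forall j, a j ord0 = 1) -> (forall j k, a j =1 a k -> j = k) ->
  (forall i j, bilin (q i) (a j) (a j) = 0) ->
  (forall j (v : 'I_n.+1 -> K), v ord0 = 0 ->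
    (forall i, bilin (q i) (a j) v + bilin (q i) v (a j) = 0) -> v =1 (fun=> 0)) ->
  (N <= 2 ^ n)%N.
Proof.
move=> a0 a_inj qa nondeg.
have Jfree j : row_free (jacobian q (a j)).
  apply: inj_row_free => v vJ.
  pose v' k := if unlift ord0 k is Some l then v ord0 l else 0.
  have v'0 : v' ord0 = 0 by rewrite /v' unlift_none.
  have v'E : \row_k v' (lift ord0 k) = v by apply/rowP => k; rewrite mxE /v' liftK.
  have v'z := nondeg j v' v'0 (fun i => _); rewrite -v'E.
  by apply/rowP => k; rewrite !mxE v'z // => i; rewrite jacobianE // v'E vJ mxE.
have [L LP] := row_free_unit_common Jfree.
pose q' i := \sum_l L l i *: q l.
have q'E i x y : bilin (q' i) x y = \sum_l L l i * bilin (q l) x y.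
  under [RHS]eq_bigr do rewrite mulr_sumr.
  rewrite exchange_big; apply: eq_bigr => s _ /=.
  under [RHS]eq_bigr do rewrite mulr_sumr.
  rewrite exchange_big; apply: eq_bigr => t _ /=.
  by rewrite summxE mulr_suml; apply: eq_bigr => l _; rewrite mxE -mulrA.
apply: (@bezout_square K n q' N a) => // [i j|j].
  by rewrite q'E big1 // => l _; rewrite qa mulr0.
suff -> : jacobian q' (a j) = jacobian q (a j) *m L by [].
apply/matrixP => k i; rewrite !mxE !q'E -big_split.
by apply: eq_bigr => l _; rewrite mxE [RHS]mulrC mulrDr.
Qed.

(** * Square roots and positivity in a C*-algebra *)

Local Notation "r %:c" := (real_complex _ r) (at level 1, format "r %:c").

Section CStarBasics.
Import numFieldNormedType.Exports.
Variables (R : realType) (C : cstarAlgType R).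
Implicit Types (x y z h s a : C) (r t : R).

Lemma star0 : star (0 : C) = 0.
Proof. by rewrite -(scale0r (0 : C)) starZ rmorph0 !scale0r. Qed.

Lemma starN x : star (- x) = - star x.
Proof. by rewrite -scaleN1r starZ rmorphN1 scaleN1r. Qed.

Lemma starB x y : star (x - y) = star x - star y.
Proof. by rewrite starD starN. Qed.

Lemma star1 : star (1 : C) = 1.
Proof. by rewrite -[LHS]mulr1 -[X in _ * X]starK -starM mulr1 starK. Qed.

Lemma conj_rc r : Num.conj r%:c = r%:c.
Proof. by apply/CrealP; rewrite complex_real. Qed.

Lemma starZr r x : star (r%:c *: x) = r%:c *: star x.
Proof. by rewrite starZ conj_rc. Qed.

Lemma star_sum I (s : seq I) P (F : I -> C) :
  star (\sum_(i <- s | P i) F i) = \sum_(i <- s | P i) star (F i).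
Proof. exact: (big_morph (@star R C) starD star0). Qed.

Lemma cnormZr r x : cnorm (r%:c *: x) = `|r| * cnorm x.
Proof. by rewrite cnormZ normc_def /= expr0n /= addr0 sqrtr_sqr. Qed.

Lemma cnorm0 : cnorm (0 : C) = 0.
Proof. by rewrite -(scale0r (0 : C)) -[0 in X in cnorm X]/(0%:c) cnormZr normr0 mul0r. Qed.

Lemma cnormN x : cnorm (- x) = cnorm x.
Proof. by rewrite -scaleN1r cnormZ normrN1 /= mul1r. Qed.

Lemma cnormB x y : cnorm (x - y) = cnorm (y - x).
Proof. by rewrite -cnormN opprB. Qed.

Lemma cnorm_ge0 x : 0 <= cnorm x.
Proof. by have := cnormD x (- x); rewrite subrr cnorm0 cnormN; lra. Qed.

Lemma cnorm_star x : cnorm (star x) = cnorm x.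
Proof.
have le y : cnorm y <= cnorm (star y).
  have [->|y0] := eqVneq (cnorm y) 0; first exact: cnorm_ge0.
  have := cnormM (star y) y; rewrite cnorm_starM expr2.
  by rewrite ler_pM2r // lt_neqAle eq_sym y0 cnorm_ge0.
by apply/le_anti; rewrite le !andbT -{2}[x]starK le.
Qed.

Lemma cnorm1 : cnorm (1 : C) = 1.
Proof.
have := cnorm_starM (1 : C); rewrite star1 mulr1 expr2.
have n0 : cnorm (1 : C) != 0 by apply/eqP => /cnorm_eq0 /eqP; rewrite oner_eq0.
by rewrite -{1}[cnorm 1]mulr1 => /(mulfI n0) <-.
Qed.

Definition clim (u : nat -> C) (l : C) : Prop :=
  forall eps : R, 0 < eps -> exists n0 : nat, forall n, (n0 <= n)%N -> cnorm (u n - l) < eps.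

Lemma clim_eq0 u l x K : clim u l ->
  (forall n, cnorm x <= K * (cnorm (u n - l) + cnorm (u n.+1 - l))) -> x = 0.
Proof.
move=> ul H; apply: cnorm_eq0; apply/le_anti; rewrite cnorm_ge0 andbT.
have [K0|K0] := lerP K 0.
  by apply: le_trans (H 0) _; rewrite mulr_le0_ge0 // addr_ge0 ?cnorm_ge0.
rewrite leNgt; apply/negP => x0.
have [|n0 n0P] := ul (cnorm x / (2 * K)); first by rewrite divr_gt0 ?mulr_gt0.
have := H n0; rewrite leNgt => /negP; apply.
have -> : cnorm x = K * (cnorm x / (2 * K) + cnorm x / (2 * K)) by field; rewrite gt_eqF.
by rewrite ltr_pM2l // ltrD ?n0P.
Qed.

(** The fixed point y of this iteration satisfies 2 y = k + y^2, that is
(1 - y)^2 = 1 - k. *)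
Fixpoint sqrt_iter (k : C) n : C :=
  if n is m.+1 then (2^-1)%:c *: (k + sqrt_iter k m * sqrt_iter k m) else 0.

(** The scalar iteration at k = 1.  Its increments dominate those of sqrt_iter for
every k in the closed unit ball, which gives convergence on the boundary too,
where the iteration is not a contraction. *)
Fixpoint sqrt_major n : R := if n is m.+1 then 2^-1 * (1 + sqrt_major m ^+ 2) else 0.

Lemma sqrt_major_itv n : 0 <= sqrt_major n <= 1.
Proof. by elim: n => [|n /andP[]] /=; [lra|nra]. Qed.

Lemma sqrt_major_gap n : 1 - sqrt_major n <= 2 / n.+1%:R.
Proof.
elim: n => [|n IHn] /=; first by rewrite divr1; lra.
have /andP[] := sqrt_major_itv n; move: IHn; move: (sqrt_major n) => e.
rewrite -[n.+2%:R]natr1 -[n.+1%:R]natr1; have := ler0n R n; move: (n%:R) => t t0.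
rewrite !ler_pdivlMr; [|lra..] => He e0 e1.
(* With p = t + 1 and d = 1 - e, this product is the gap left in
   (p + 1) (d - d^2 / 2) <= 2 up to the square d^2 / 2. *)
have : 0 <= (2 - (1 - e) * (t + 1)) * (1 - (1 - e) / 2) by rewrite mulr_ge0; lra.
nra.
Qed.

Lemma sqrt_iter_norm k n : cnorm k <= 1 -> cnorm (sqrt_iter k n) <= sqrt_major n.
Proof.
move=> k1; elim: n => [|n IHn] /=; first by rewrite cnorm0.
rewrite cnormZr ger0_norm ?invr_ge0 // ler_pM2l ?invr_gt0 //.
apply: le_trans (cnormD _ _) (lerD k1 (le_trans (cnormM _ _) _)).
by rewrite expr2 ler_pM ?cnorm_ge0.
Qed.

Lemma sqrt_iter_step k n : cnorm k <= 1 ->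
  cnorm (sqrt_iter k n.+1 - sqrt_iter k n) <= sqrt_major n.+1 - sqrt_major n.
Proof.
move=> k1; elim: n => [|n IHn].
  by rewrite /= !mulr0 !subr0 addr0 cnormZr ger0_norm ?invr_ge0 // expr0n /= addr0 ler_pM2l ?invr_gt0.
set y := sqrt_iter k; set e := sqrt_major in IHn *.
have -> : y n.+2 - y n.+1 = (2^-1)%:c *: (y n.+1 * (y n.+1 - y n) + (y n.+1 - y n) * y n).
  rewrite -[y n.+2]/((2^-1)%:c *: (k + y n.+1 * y n.+1)).
  rewrite -[X in _ - X = _]/((2^-1)%:c *: (k + y n * y n)) -scalerBr; congr (_ *: _).
  by rewrite mulrBr mulrBl addrA subrK opprD addrACA subrr add0r.
rewrite cnormZr ger0_norm ?invr_ge0 //.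
have -> : e n.+2 - e n.+1 = 2^-1 * (e n.+1 * (e n.+1 - e n) + (e n.+1 - e n) * e n).
  by rewrite -[e n.+2]/(2^-1 * (1 + e n.+1 ^+ 2)) -[X in _ - X = _]/(2^-1 * (1 + e n ^+ 2)); ring.
rewrite ler_pM2l ?invr_gt0 //; apply: le_trans (cnormD _ _) _.
by rewrite lerD // (le_trans (cnormM _ _)) // ler_pM ?cnorm_ge0 // sqrt_iter_norm.
Qed.

Lemma sqrt_iter_dist k n m : cnorm k <= 1 -> (n <= m)%N ->
  cnorm (sqrt_iter k m - sqrt_iter k n) <= sqrt_major m - sqrt_major n.
Proof.
move=> k1 /subnK <-; elim: (m - n)%N => [|d IHd]; first by rewrite add0n !subrr cnorm0.
rewrite addSn -(subrK (sqrt_iter k (d + n)) (sqrt_iter k _.+1)) -addrA.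
apply: le_trans (cnormD _ _) _.
by have := sqrt_iter_step (d + n) k1; move: IHd; lra.
Qed.

Lemma sqrt_iter_cvg k : cnorm k <= 1 -> exists l, clim (sqrt_iter k) l.
Proof.
move=> k1; have [|l lP] := @cnorm_complete R C (sqrt_iter k); last by exists l.
move=> eps eps0; have [n0 n0P] : exists n0, 2 / n0.+1%:R < eps.
  have := archi_boundP (ltW (divr_gt0 (ltr0Sn R 1) eps0)).
  set N := Num.bound _ => NP; exists N.
  rewrite ltr_pdivrMr // mulrC -ltr_pdivrMr //; apply: lt_le_trans NP _.
  by rewrite ler_nat.
exists n0 => m n n0m n0n.
wlog nm : m n n0m n0n / (n <= m)%N.
  by move=> H; have [/H|/ltnW /H] := leqP n m; rewrite 1?cnormB; apply.
apply: le_lt_trans (sqrt_iter_dist k1 nm) _.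
have /andP[_ m1] := sqrt_major_itv m.
apply: le_lt_trans (lerB m1 (lexx _)) _.
apply: le_lt_trans (sqrt_major_gap n) _.
apply: le_lt_trans n0P; rewrite ler_pM2l // lef_pV2 ?posrE // ler_nat.
by [].
Qed.

(** Positivity without spectrum: in the commutative picture the norm condition says
that h takes its values in [0, 2 t].  In this form the cone is visibly closed under
sums; that it contains all star y * y is psd_starM. *)
Definition psd h : Prop := star h = h /\ exists t, cnorm (t%:c *: 1 - h) <= t.

Lemma psd_bound h : psd h -> exists t, 0 < t /\ cnorm (t%:c *: 1 - h) <= t.
Proof.
case=> _ [t tP]; exists (t + 1); have := le_trans (cnorm_ge0 _) tP; split; first lra.
rewrite rmorphD scalerDl addrAC; apply: le_trans (cnormD _ _) _.
by rewrite lerD // scale1r cnorm1.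
Qed.

Lemma psdD h h' : psd h -> psd h' -> psd (h + h').
Proof.
move=> [hs [t tP]] [hs' [t' tP']]; split; first by rewrite starD hs hs'.
exists (t + t'); rewrite rmorphD scalerDl opprD addrACA.
exact: le_trans (cnormD _ _) (lerD tP tP').
Qed.

Lemma psd0 : psd 0.
Proof. by split; [exact: star0|exists 0; rewrite scale0r subr0 cnorm0]. Qed.

Lemma psd_sum I (s : seq I) (P : pred I) (F : I -> C) :
  (forall i, P i -> psd (F i)) -> psd (\sum_(i <- s | P i) F i).
Proof. by move=> H; apply: big_ind => //; [exact: psd0|exact: psdD]. Qed.

Lemma psdZ r h : 0 <= r -> psd h -> psd (r%:c *: h).
Proof.
move=> r0 [hs [t tP]]; split; first by rewrite starZr hs.
exists (r * t); rewrite rmorphM -scalerA -scalerBr cnormZr ger0_norm //.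
by rewrite ler_wpM2l.
Qed.

(** Being a limit of polynomials in h, the root commutes with whatever commutes
with h and stays in every C*-subalgebra that contains h. *)
Lemma psd_sqrt h : psd h -> exists s, [/\ psd s, s * s = h,
  forall z, z * h = h * z -> z * s = s * z
  & forall A, cstar_subalgebra A -> A h -> A s].
Proof.
move=> hP; have [t [t0 tP]] := psd_bound hP; have [hs _] := hP.
pose k := 1 - (t^-1)%:c *: h.
have kE : h = t%:c *: (1 - k).
  by rewrite /k opprB addrC subrK scalerA -rmorphM mulfV ?gt_eqF // scale1r.
have k1 : cnorm k <= 1.
  have -> : k = (t^-1)%:c *: (t%:c *: 1 - h).
    by rewrite scalerBr scalerA -rmorphM mulVf ?gt_eqF // scale1r.
  by rewrite cnormZr ger0_norm ?invr_ge0 ?(ltW t0) // ler_pdivrMl ?mulr1.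
have ks : star k = k by rewrite starB star1 starZr hs.
have [l lP] := sqrt_iter_cvg k1.
set y := sqrt_iter k in lP.
have y1 n : cnorm (y n) <= 1.
  have /andP[_] := sqrt_major_itv n; exact: le_trans (sqrt_iter_norm _ k1).
have ys n : star (y n) = y n.
  by elim: n => [|n IHn] /=; rewrite ?star0 // starZr starD starM ks -/y IHn.
have ls : star l = l.
  apply/eqP; rewrite -subr_eq0; apply/eqP; apply: (clim_eq0 (K := 2) lP) => n.
  have -> : star l - l = - star (y n - l) + (y n - l).
    by rewrite starB ys; ncring.
  apply: le_trans (cnormD _ _) _; rewrite cnormN cnorm_star.
  by have := cnorm_ge0 (y n.+1 - l); lra.
have l1 : cnorm l <= 1.
  rewrite leNgt; apply/negP => l1; have [|n /(_ n (leqnn n)) nP] := lP (cnorm l - 1).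
    by rewrite subr_gt0.
  have := cnormD (l - y n) (y n); rewrite subrK cnormB; have := y1 n; move: nP; lra.
have lk : l + l = k + l * l.
  apply/eqP; rewrite -subr_eq0; apply/eqP.
  apply: (clim_eq0 (K := 2 + (1 + cnorm l)) lP) => n.
  have yE : y n.+1 + y n.+1 = k + y n * y n.
    rewrite -[y n.+1]/((2^-1)%:c *: (k + y n * y n)) -scalerDl -rmorphD.
    by rewrite (_ : 2^-1 + 2^-1 = 1 :> R) ?rmorph1 ?scale1r //; lra.
  have -> : l + l - (k + l * l) =
      ((l - y n.+1) + (l - y n.+1)) + (y n * (y n - l) + (y n - l) * l).
    rewrite [RHS](_ : _ = l + l - (y n.+1 + y n.+1) + (y n * y n - l * l)); last ncring.
    by rewrite yE; ncring.
  apply: le_trans (cnormD _ _) _.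
  have := cnormD (l - y n.+1) (l - y n.+1); rewrite [cnorm (l - _)]cnormB.
  have := cnormD (y n * (y n - l)) ((y n - l) * l).
  have := cnormM (y n) (y n - l); have := cnormM (y n - l) l.
  have := y1 n; move: (cnorm_ge0 (y n - l)) (cnorm_ge0 (y n.+1 - l)) (cnorm_ge0 l).
  move: (cnorm (y n - l)) (cnorm (y n.+1 - l)) (cnorm l) (cnorm (y n)) (cnorm _) (cnorm _) (cnorm _) (cnorm _) => *.
  nra.
exists ((Num.sqrt t)%:c *: (1 - l)); split.
- split; first by rewrite starZr starB star1 ls.
  exists (Num.sqrt t); rewrite -scalerBr opprB addrC subrK cnormZr ger0_norm ?sqrtr_ge0 //.
  by rewrite -{2}[Num.sqrt t]mulr1 ler_wpM2l ?sqrtr_ge0.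
- rewrite -scalerAl -scalerAr scalerA -rmorphM -expr2 sqr_sqrtr 1?ltW // kE; congr (_ *: _).
  rewrite (_ : (1 - l) * (1 - l) = 1 - (l + l) + l * l); last ncring.
  by rewrite lk; ncring.
- move=> z zh; have zk : z * k = k * z.
    by rewrite mulrBl mulrBr mul1r mulr1 -scalerAl -scalerAr zh.
  have zy n : z * y n = y n * z.
    elim: n => [|n IHn] /=; first by rewrite mul0r mulr0.
    rewrite -scalerAl -scalerAr mulrDr mulrDl zk -/y; congr (_ *: (_ + _)).
    by rewrite mulrA IHn -mulrA IHn mulrA.
  suff zl : z * l = l * z by rewrite -scalerAl -scalerAr mulrBl mulrBr mul1r mulr1 zl.
  apply/eqP; rewrite -subr_eq0; apply/eqP.
  apply: (clim_eq0 (K := 2 * cnorm z) lP) => n.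
  have -> : z * l - l * z = (y n - l) * z - z * (y n - l) + (z * y n - y n * z) by ncring.
  rewrite zy subrr addr0; apply: le_trans (cnormD _ _) _; rewrite cnormN.
  have := cnormM z (y n - l); have := cnormM (y n - l) z.
  have := mulr_ge0 (cnorm_ge0 z) (cnorm_ge0 (y n.+1 - l)).
  move: (cnorm (z * _)) (cnorm (_ * z)) (cnorm (y n - l)) (cnorm (y n.+1 - l)) => *; lra.
move=> A [A1 Alin AM Astar Acl] Ah.
have A0 : A 0 by have := Alin (-1) 1 1 A1 A1; rewrite scaleN1r addNr.
have AZ c x : A x -> A (c *: x) by move=> Ax; rewrite -[_ *: _]addr0; apply: Alin.
have AD x x' : A x -> A x' -> A (x + x') by move=> ? ?; rewrite -[x]scale1r; apply: Alin.
have AB x x' : A x -> A x' -> A (x - x') by move=> ? ?; rewrite addrC -scaleN1r; apply: Alin.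
apply/AZ/AB => //; apply: Acl => eps /lP[n0 n0P]; exists (y n0).
  elim: (n0) => [|n IHn] //=; apply/AZ/AD; last exact: AM.
  by apply/AB => //; apply: AZ.
by rewrite cnormB n0P.
Qed.

(** Since a and b commute, u = a + i b satisfies star u * u = a^2 + b^2 and a is the
real part of u. *)
Lemma sqr_norm_le a b r : star a = a -> star b = b -> a * b = b * a ->
  a * a + b * b = r%:c *: 1 -> cnorm a ^+ 2 <= `|r|.
Proof.
move=> sa sb ab abr; pose i : R[i] := Complex 0 1; pose u := a + i *: b.
have ii : i * i = - 1 by apply/eqP; rewrite eq_complex /=; apply/andP; split; apply/eqP; ring.
have su : star u = a - i *: b.
  rewrite /u starD starZ sa sb -scaleNr; congr (_ + _ *: _).
  by apply/eqP; rewrite eq_complex /= oppr0 !eqxx.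
have uu : star u * u = r%:c *: 1.
  rewrite -abr su /u mulrBl !mulrDr -!scalerAl -!scalerAr scalerA ii ab scaleN1r.
  by rewrite opprB addrACA subrr addr0.
have nu : cnorm u ^+ 2 = `|r| by rewrite -cnorm_starM uu cnormZr cnorm1 mulr1.
have : a + a = u + star u by rewrite su /u; ncring.
move=> au; rewrite -nu ler_sqr ?nnegrE ?cnorm_ge0 //.
have : cnorm (a + a) = 2 * cnorm a.
  rewrite (_ : a + a = 2%:c *: a) ?cnormZr ?ger0_norm //.
  by rewrite (_ : 2 = 1 + 1 :> R) // rmorphD scalerDl scale1r.
by have := cnormD u (star u); rewrite -au cnorm_star; lra.
Qed.

(** After scaling, b and s = sqrt (1 - b^2) are the real and imaginary parts of a
unitary, so 1 - b^2 = s^2 has norm at most 1. *)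
Lemma psd_sqr a : star a = a -> psd (a * a).
Proof.
move=> sa; pose t := cnorm a + 1; have t0 : 0 < t by rewrite ltr_wpDl ?cnorm_ge0.
pose b := (t^-1)%:c *: a.
have sb : star b = b by rewrite starZr sa.
have b1 : cnorm b <= 1.
  rewrite cnormZr ger0_norm ?invr_ge0 ?(ltW t0) // ler_pdivrMl // mulr1.
  by rewrite /t lerDl.
have ab : a = t%:c *: b by rewrite scalerA -rmorphM mulfV ?gt_eqF // scale1r.
have : psd (1 - b * b).
  split; first by rewrite starB star1 starM sb.
  exists 1; rewrite scale1r opprB addrC subrK (le_trans (cnormM _ _)) //.
  by rewrite -[1]mulr1 ler_pM ?cnorm_ge0.
move=> /psd_sqrt[s [[ss _] ssE scomm _]].
have bs : b * s = s * b by apply: scomm; ncring.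
have : psd (b * b).
  split; first by rewrite starM sb.
  have := @sqr_norm_le s b 1 ss sb (esym bs); rewrite ssE scale1r subrK normr1 => /(_ erefl).
  exists 1; rewrite scale1r -ssE; apply: le_trans (cnormM _ _) _.
  by rewrite -expr2.
move=> bb; rewrite ab -scalerAl -scalerAr scalerA -rmorphM; apply: psdZ => //.
by rewrite -expr2 sqr_ge0.
Qed.

(** Write h = a^2 and - h = b^2 with commuting roots; then a^2 + b^2 = 0. *)
Lemma psd_antisym h : psd h -> psd (- h) -> h = 0.
Proof.
move=> /psd_sqrt[a [[sa _] aa _ _]] /psd_sqrt[b [[sb _] bb bcomm _]].
have ab : a * b = b * a by apply: bcomm; rewrite -aa; ncring.
have /(sqr_norm_le sa sb ab) : a * a + b * b = 0%:c *: 1 by rewrite aa bb subrr scale0r.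
rewrite normr0 exprn_even_le0 //= => /eqP /cnorm_eq0 a0.
by rewrite -aa a0 mul0r.
Qed.

Lemma selfadj_sqr_eq0 a : star a = a -> a * a = 0 -> a = 0.
Proof.
move=> sa aa; apply: cnorm_eq0; apply/eqP; rewrite -sqrf_eq0 -cnorm_starM sa aa.
by rewrite cnorm0.
Qed.

Lemma star_mul_eq0 y : star y * y = 0 -> y = 0.
Proof.
by move=> yy; apply: cnorm_eq0; apply/eqP; rewrite -sqrf_eq0 -cnorm_starM yy cnorm0.
Qed.

(** Twice this element is the sum of the squares of z + star z and i (z - star z). *)
Lemma psd_starM_add z : psd (star z * z + z * star z).
Proof.
pose i : R[i] := Complex 0 1; pose p := z + star z; pose w := i *: (z - star z).
have ii : i * i = - 1 by apply/eqP; rewrite eq_complex /=; apply/andP; split; apply/eqP; ring.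
have sp : star p = p by rewrite starD starK addrC.
have sw : star w = w.
  rewrite starZ starB starK -opprB scalerN -scaleNr; congr (_ *: _).
  by apply/eqP; rewrite eq_complex /= oppr0 opprK !eqxx.
have -> : star z * z + z * star z = (2^-1)%:c *: (p * p + w * w).
  rewrite -scalerAl -scalerAr scalerA ii scaleN1r.
  rewrite (_ : p * p - _ = (star z * z + z * star z) + (star z * z + z * star z)); last first.
    by rewrite /p; ncring.
  rewrite scalerDr -scalerDl -rmorphD (_ : 2^-1 + 2^-1 = 1 :> R); last lra.
  by rewrite rmorph1 scale1r.
by apply: psdZ; [rewrite invr_ge0|apply: psdD; exact: psd_sqr].
Qed.

(** Apply psd_starM_add to x = z * g: here x * star x = - s^4 with s^2 = z * star z,
and star x * x = - g^4, so that s^4 is both positive and negative. *)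
Lemma neg_starM_eq0 z g : star g = g -> star z * z = - (g * g) -> z = 0.
Proof.
move=> sg zz.
have hP : psd (z * star z).
  have -> : z * star z = (star z * z + z * star z) + g * g by rewrite zz; ncring.
  by apply: psdD; [exact: psd_starM_add|exact: psd_sqr].
have [s [[ss _] sE _ _]] := psd_sqrt hP.
pose x := z * g.
have xx : x * star x = - ((s * s) * (s * s)).
  rewrite starM sg sE (_ : z * star z * (z * star z) = z * (star z * z) * star z); last ncring.
  by rewrite zz /x; ncring.
have xx' : star x * x = - ((g * g) * (g * g)).
  rewrite starM sg /x (_ : g * star z * _ = g * (star z * z) * g); last ncring.
  by rewrite zz; ncring.
have s2 : star (s * s) = s * s by rewrite starM ss.
have g2 : star (g * g) = g * g by rewrite starM sg.
have s4 : (s * s) * (s * s) = 0.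
  apply: psd_antisym; first exact: psd_sqr.
  have -> : - (s * s * (s * s)) = (star x * x + x * star x) + (g * g) * (g * g).
    by rewrite xx xx'; ncring.
  by apply: psdD; [exact: psd_starM_add|exact: psd_sqr].
have := selfadj_sqr_eq0 s2 s4; rewrite sE -{1}[z]starK => /star_mul_eq0 sz.
by rewrite -[z]starK sz star0.
Qed.

(** Let r = sqrt (a^2) be the absolute value of a = star y * y, so that n = r - a is
twice the negative part of a.  Then star (y n) * (y n) = n a n = - n r n is minus a
square, whence y n = 0 and finally n = 0. *)
Theorem psd_starM y : psd (star y * y).
Proof.
set a := star y * y.
have sa : star a = a by rewrite starM starK.
have [r [rP rE rcomm _]] := psd_sqrt (psd_sqr sa); have [sr _] := rP.
have ar : a * r = r * a by apply: rcomm; ncring.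
have [q [[sq _] qE qcomm _]] := psd_sqrt rP.
pose n := r - a.
have sn : star n = n by rewrite starB sr sa.
have qn : q * n = n * q.
  by apply/esym/qcomm; rewrite /n mulrBl mulrBr ar.
have na : n * a = - (n * r).
  apply/eqP; rewrite -subr_eq0 opprK; apply/eqP.
  have -> : n * a + n * r = r * r - a * a + (r * a - a * r) by rewrite /n; ncring.
  by rewrite rE ar !subrr addr0.
pose g := q * n.
have sg : star g = g by rewrite starM sq sn -qn.
have /(neg_starM_eq0 sg) yn : star (y * n) * (y * n) = - (g * g).
  rewrite starM sn (_ : n * star y * (y * n) = n * a * n); last by rewrite /a; ncring.
  by rewrite na -qE /g {1}qn; ncring.
have nan : n * a = 0.
  have : star (y * n) * y = 0 by rewrite yn star0 mul0r.
  by rewrite starM sn -mulrA.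
have nr : n * r = 0 by rewrite -[n * r]opprK -na nan oppr0.
have : n = 0 by apply: selfadj_sqr_eq0 => //; rewrite {2}/n mulrBr nan nr subrr.
by move/eqP; rewrite subr_eq0 => /eqP <-.
Qed.

Lemma psd_conj z h : psd h -> psd (star z * h * z).
Proof.
move=> /psd_sqrt[s [[ss _] <- _ _]].
rewrite (_ : star z * (s * s) * z = star (s * z) * (s * z)); first exact: psd_starM.
by rewrite starM ss; ncring.
Qed.

Lemma scal_inj (b c : R[i]) : b *: (1 : C) = c *: 1 -> b = c.
Proof.
move/eqP; rewrite -subr_eq0 -scalerBl scaler_eq0 oner_eq0 orbF subr_eq0.
by move/eqP.
Qed.

Lemma psd_scalar (c : R[i]) : psd (c *: (1 : C)) -> 0 <= c.
Proof.
move=> [/esym]; rewrite starZ star1 => /scal_inj cc [t].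
have -> : c = (complex.Re c)%:c.
  apply/eqP; rewrite eq_complex /= eqxx /=.
  by move: cc; case: (c) => a b [] /= ?; apply/eqP; lra.
rewrite -scalerBl -rmorphB cnormZr cnorm1 mulr1 => H.
by rewrite -[0]/(0%:c) lecR; have := ler_norm (t - complex.Re c); lra.
Qed.

Lemma cstar_subalgebra_closure A : cstar_subalgebra A ->
  [/\ A 0, forall c x, A x -> A (c *: x), forall x y, A x -> A y -> A (x + y),
      forall x y, A x -> A y -> A (x - y) & forall x, A x -> A (- x)].
Proof.
move=> [A1 Alin _ _ _].
have A0 : A 0 by have := Alin (-1) 1 1 A1 A1; rewrite scaleN1r addNr.
have AZ c x : A x -> A (c *: x) by move=> Ax; rewrite -[_ *: _]addr0; apply: Alin.
have AD x y : A x -> A y -> A (x + y) by move=> ? ?; rewrite -[x]scale1r; apply: Alin.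
have AN x : A x -> A (- x) by rewrite -scaleN1r; exact: AZ.
by split=> // x y Ax Ay; apply/AD/AN.
Qed.

Fixpoint geom_iter (k : C) n : C := if n is m.+1 then 1 + k * geom_iter k m else 0.

(** The iterates are the partial sums of the geometric series. *)
Lemma neumann k r : cnorm k <= r -> r < 1 -> exists z,
  [/\ z * (1 - k) = 1, (1 - k) * z = 1
   & forall A, cstar_subalgebra A -> A k -> A z].
Proof.
move=> kr r1; have r0 : 0 <= r := le_trans (cnorm_ge0 k) kr.
set y := geom_iter k.
have step n : cnorm (y n.+1 - y n) <= r ^+ n.
  elim: n => [|n IHn]; first by rewrite /y /= mulr0 addr0 subr0 cnorm1.
  have -> : y n.+2 - y n.+1 = k * (y n.+1 - y n).
    by rewrite -[y n.+2]/(1 + k * y n.+1) -[X in _ - X = _]/(1 + k * y n); ncring.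
  by rewrite exprS (le_trans (cnormM _ _)) // ler_pM ?cnorm_ge0.
have dist n d : cnorm (y (d + n)%N - y n) <= (r ^+ n - r ^+ (d + n)) / (1 - r).
  elim: d => [|d IHd]; first by rewrite !subrr cnorm0 mul0r.
  rewrite addSn -(subrK (y (d + n)%N) (y _.+1)) -addrA.
  apply: le_trans (cnormD _ _) _; apply: le_trans (lerD (step _) IHd) _.
  by rewrite exprS le_eqVlt; apply/orP; left; apply/eqP; field; rewrite subr_eq0 gt_eqF.
have [|l lP] := @cnorm_complete R C y.
  move=> eps eps0; have /cvgrPdist_lt /(_ (eps * (1 - r))) : r ^+ n @[n --> \oo] --> (0 : R).
    by apply: cvg_expr; rewrite ger0_norm.
  rewrite mulr_gt0 ?subr_gt0 // => /(_ isT) [n0 _ n0P]; exists n0 => m n n0m n0n.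
  wlog nm : m n n0m n0n / (n <= m)%N.
    by move=> H; have [/H|/ltnW /H] := leqP n m; rewrite 1?cnormB; apply.
  have := n0P n n0n; rewrite /= sub0r normrN ger0_norm ?exprn_ge0 // -ltr_pdivrMr ?subr_gt0 //.
  apply: le_lt_trans; rewrite -{1}(subnK nm); apply: le_trans (dist _ _) _.
  by rewrite ler_pM2r ?invr_gt0 ?subr_gt0 // gerBl exprn_ge0.
have yk n : y n * k = k * y n.
  elim: n => [|n IHn]; first by rewrite /y /= mul0r mulr0.
  by rewrite -[y n.+1]/(1 + k * y n) mulrDl -mulrA IHn; ncring.
have lk : l * k = k * l.
  apply/eqP; rewrite -subr_eq0; apply/eqP.
  apply: (clim_eq0 (K := 2 * cnorm k) lP) => n.
  have -> : l * k - k * l = k * (y n - l) - (y n - l) * k + (y n * k - k * y n) by ncring.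
  rewrite yk subrr addr0; apply: le_trans (cnormD _ _) _; rewrite cnormN.
  have := cnormM k (y n - l); have := cnormM (y n - l) k.
  have := mulr_ge0 (cnorm_ge0 k) (cnorm_ge0 (y n.+1 - l)).
  move: (cnorm (k * _)) (cnorm (_ * k)) (cnorm (y n - l)) (cnorm (y n.+1 - l)) => *; lra.
have ll : l - (1 + k * l) = 0.
  apply: (clim_eq0 (K := 1 + cnorm k) lP) => n.
  have -> : l - (1 + k * l) = k * (y n - l) - (y n.+1 - l).
    by rewrite -[y n.+1]/(1 + k * y n); ncring.
  apply: le_trans (cnormD _ _) _; rewrite cnormN.
  have := cnormM k (y n - l); have := mulr_ge0 (cnorm_ge0 k) (cnorm_ge0 (y n.+1 - l)).
  have := cnorm_ge0 (y n - l).
  move: (cnorm (k * _)) (cnorm (y n - l)) (cnorm (y n.+1 - l)) => *; nra.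
have kl : (1 - k) * l = 1.
  rewrite (_ : (1 - k) * l = l - (1 + k * l) + 1); last ncring.
  by rewrite ll add0r.
exists l; split=> //.
  by rewrite -[RHS]kl mulrBr mulrBl mulr1 mul1r lk.
move=> A Asub Ak; have [A0 AZ AD AB _] := cstar_subalgebra_closure Asub.
have [A1 _ AM _ Acl] := Asub.
apply: Acl => eps /lP[n0 n0P]; exists (y n0); last by rewrite cnormB n0P.
by elim: (n0) => [|n IHn] //=; apply: AD => //; exact: AM.
Qed.

(** An element bounded below by r > 0 is a multiple of 1 - k with k of norm less
than 1. *)
Lemma psd_inv_sqrt h r A : cstar_subalgebra A -> A h -> 0 < r -> psd (h - r%:c *: 1) ->
  exists s v, [/\ A s /\ A v, star s = s /\ star v = v, s * s = h & s * v = 1 /\ v * s = 1].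
Proof.
move=> Asub Ah r0 hr; have [A0 AZ AD AB AN] := cstar_subalgebra_closure Asub.
have [A1 _ AM Astar _] := Asub.
have hP : psd h.
  rewrite -[h](subrK (r%:c *: 1)); apply: psdD => //; apply: psdZ; first exact: ltW.
  by have := psd_starM 1; rewrite star1 mulr1.
have [s [[ss _] sE scomm sA]] := psd_sqrt hP.
have [t [t0 tP]] := psd_bound hr.
pose k := 1 - ((t + r)^-1)%:c *: h.
have tr0 : 0 < t + r by rewrite addr_gt0.
have kr : cnorm k <= t / (t + r).
  have -> : k = ((t + r)^-1)%:c *: (t%:c *: 1 - (h - r%:c *: 1)).
    rewrite opprB addrA -scalerDl -rmorphD scalerBr scalerA -rmorphM mulVf ?gt_eqF //.
    by rewrite scale1r.
  by rewrite cnormZr ger0_norm ?invr_ge0 ?(ltW tr0) // mulrC ler_pM2r ?invr_gt0.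
have [|z [zl zr zA]] := neumann kr; first by rewrite ltr_pdivrMr // mul1r ltrDl.
have kE : 1 - k = ((t + r)^-1)%:c *: h by rewrite /k opprB addrC subrK.
have Ak : A k by exact: AB A1 (AZ _ _ Ah).
pose w := ((t + r)^-1)%:c *: z.
have wh : w * h = 1 by rewrite -scalerAl -[RHS]zl kE -scalerAr.
have hw : h * w = 1 by rewrite -scalerAr -[RHS]zr kE -scalerAl.
have sw : s * w = w * s.
  rewrite -[s * w]mul1r -{1}wh -[RHS]mulr1 -hw !mulrA; congr (_ * _).
  by rewrite -[w * h * s]mulrA -[w * s * h]mulrA -sE !mulrA.
have sv : s * (s * w) = 1 by rewrite mulrA sE hw.
have vs : (s * w) * s = 1 by rewrite sw -mulrA sE wh.
exists s, (s * w); split=> //.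
- split; first exact: sA.
  apply: AM; first exact: sA.
  exact: AZ (zA _ Asub Ak).
- split=> //.
  have svs : star (s * w) * s = 1 by rewrite -{2}ss -starM sv star1.
  by rewrite -[LHS]mulr1 -sv mulrA svs mul1r.
Qed.

End CStarBasics.

(** * Conditional expectations *)

Section CondExp.
Variables (R : realType) (C : cstarAlgType R) (A : set C) (E : C -> C).
Hypotheses (hA : cstar_subalgebra A) (hE : conditional_expectation A E).

Lemma condE_linear c x y : E (c *: x + y) = c *: E x + E y.
Proof. by case: hE. Qed.

Lemma condE_mem x : A (E x).
Proof. by case: hE. Qed.

Lemma condE_id a : A a -> E a = a.
Proof. by case: hE => _ _ + _ _; exact. Qed.

Lemma condED x y : E (x + y) = E x + E y.
Proof. by rewrite -[x]scale1r condE_linear !scale1r. Qed.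

Lemma condE0 : E 0 = 0.
Proof. by apply: condE_id; have [] := cstar_subalgebra_closure hA. Qed.

Lemma condEZ c x : E (c *: x) = c *: E x.
Proof. by rewrite -[c *: x]addr0 condE_linear condE0 addr0. Qed.

Lemma condEN x : E (- x) = - E x.
Proof. by rewrite -scaleN1r condEZ scaleN1r. Qed.

Lemma condEB x y : E (x - y) = E x - E y.
Proof. by rewrite condED condEN. Qed.

Lemma condE_sum I (s : seq I) P (F : I -> C) :
  E (\sum_(i <- s | P i) F i) = \sum_(i <- s | P i) E (F i).
Proof. exact: (big_morph E condED condE0). Qed.

Lemma condE1 : E 1 = 1.
Proof. by apply: condE_id; case: hA. Qed.

Lemma condEMl a x : A a -> E (a * x) = a * E x.
Proof.
by case: hE => _ _ _ bim _ Aa; case: hA => A1 _ _ _ _; have := bim a x 1 Aa A1; rewrite !mulr1.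
Qed.

Lemma condEMr a x : A a -> E (x * a) = E x * a.
Proof.
by case: hE => _ _ _ bim _ Aa; case: hA => A1 _ _ _ _; have := bim 1 x a A1 Aa; rewrite !mul1r.
Qed.

Lemma condE_psd h : psd h -> psd (E h).
Proof.
move=> /psd_sqrt[s [[ss _] <- _ _]].
have [_ _ _ _ Epos] := hE; have [|z ->] := Epos (s * s); last exact: psd_starM.
by exists s; rewrite ss.
Qed.

(** For self-adjoint y, the element |y| 1 + y is positive, so its image is positive and
in particular self-adjoint. *)
Lemma condE_star x : E (star x) = star (E x).
Proof.
have herm y : star y = y -> star (E y) = E y.
  move=> sy; have : psd ((cnorm y)%:c *: 1 + y).
    split; first by rewrite starD starZr star1 sy.
    by exists (cnorm y); rewrite opprD addNKr cnormN.
  move=> /condE_psd[+ _]; rewrite condED condEZ condE1 starD starZr star1.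
  exact: addrI.
pose i : R[i] := Complex 0 1; pose d := x - star x.
have ii : i * i = - 1 by apply/eqP; rewrite eq_complex /=; apply/andP; split; apply/eqP; ring.
have ci : Num.conj i = - i by apply/eqP; rewrite eq_complex /= oppr0 !eqxx.
have sd : star d = - d by rewrite starB starK opprB.
have sEd : star (E d) = - E d.
  have := herm (i *: d); rewrite starZ ci sd scaleNr scalerN opprK => /(_ erefl).
  rewrite condEZ starZ ci => /(congr1 (fun z => i *: z)).
  by rewrite !scalerA mulrN ii opprK scale1r scaleN1r.
have sEs : star (E (x + star x)) = E (x + star x) by rewrite herm // starD starK addrC.
have two : E (star x) + E (star x) = star (E x) + star (E x).
  have -> : star (E x) + star (E x) = star (E (x + star x)) + star (E d).
    by rewrite -!starD -!condED /d; congr (star (E _)); ncring.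
  by rewrite sEs sEd -condEN -!condED /d; congr (E _); ncring.
apply/eqP; rewrite -subr_eq0; move/eqP: two; rewrite -subr_eq0 opprD addrACA.
by rewrite -mulr2n -scaler_nat scaler_eq0 pnatr_eq0.
Qed.

(** This is E applied to star (y - E y) * (y - E y). *)
Lemma condE_schwarz y : psd (E (star y * y) - star (E y) * E y).
Proof.
have EA := condE_mem y; have [_ _ _ Astar _] := hA.
have := condE_psd (psd_starM (y - E y)).
rewrite starB mulrBl !mulrBr !condEB (condEMr _ EA) (condEMl _ (Astar _ EA)).
by rewrite (condEMl _ (Astar _ EA)) condE_star (condE_id EA) subrr subr0.
Qed.

Definition quasi_basis_star n (w : 'I_n -> C) : Prop :=
  forall x, x = \sum_i w i * E (star (w i) * x).

End CondExp.

(** * Cholesky decomposition over a C*-subalgebra *)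

Section Cholesky.
Variables (R : realType) (C : cstarAlgType R) (A : set C).
Hypothesis hA : cstar_subalgebra A.

Definition ocons (T : Type) n (c : T) (f : 'I_n -> T) : 'I_n.+1 -> T :=
  fun k => if unlift ord0 k is Some l then f l else c.

Lemma ocons0 (T : Type) n (c : T) (f : 'I_n -> T) : ocons c f ord0 = c.
Proof. by rewrite /ocons unlift_none. Qed.

Lemma oconsS (T : Type) n (c : T) (f : 'I_n -> T) l : ocons c f (lift ord0 l) = f l.
Proof. by rewrite /ocons liftK. Qed.

(** The first row of the factor is G_00^(-1/2) G_0j, and the remaining matrix is the
Schur complement S.  Completing b by the entry b0 that minimises the quadratic form
shows that S inherits the lower bound r. *)
Lemma cholesky m (G : 'I_m -> 'I_m -> C) r : 0 < r -> (forall i j, A (G i j)) ->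
  (forall i j, star (G i j) = G j i) ->
  (forall b : 'I_m -> C, (forall i, A (b i)) ->
     psd (\sum_i \sum_j star (b i) * G i j * b j - r%:c *: \sum_i star (b i) * b i)) ->
  exists beta : 'I_m -> 'I_m -> C, (forall k i, A (beta k i)) /\
    forall i j, G i j = \sum_k star (beta k i) * beta k j.
Proof.
move=> r0; have [A0 AZ AD AB AN] := cstar_subalgebra_closure hA.
have [A1 _ AM Astar _] := hA.
elim: m G => [|m IHm] G GA Gs Gpos; first by exists (fun _ _ => 0); split=> -[].
have [|s [v [[sA vA] [ss sv] sE [svE vsE]]]] := psd_inv_sqrt hA (GA ord0 ord0) r0.
  have := Gpos (ocons 1 (fun=> 0)); rewrite !big_ord_recl !ocons0 star1 !mul1r !mulr1.
  rewrite !big1 => [|i _|i _|i _]; rewrite ?oconsS ?star0 ?mul0r ?mulr0 ?addr0; first last.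
  - by [].
  - by rewrite big1 // => j _; rewrite ?mul0r.
  - by [].
  by apply=> k; rewrite /ocons; case: unlift.
pose gam j := v * G ord0 (lift ord0 j).
have gamA j : A (gam j) by exact: AM.
have G0S j : G ord0 (lift ord0 j) = s * gam j by rewrite /gam mulrA svE mul1r.
have GS0 j : G (lift ord0 j) ord0 = star (gam j) * s.
  by rewrite -Gs G0S starM ss.
pose S i j := G (lift ord0 i) (lift ord0 j) - star (gam i) * gam j.
have [||b bA|beta [betaA betaE]] := IHm S.
- by move=> i j; apply: AB => //; apply: AM => //; exact: Astar.
- by move=> i j; rewrite starB Gs starM starK.
- pose g := \sum_j gam j * b j; pose b0 := - (v * g).
  have gA : A g by apply: big_ind => // j _; exact: AM.
  have /Gpos : forall i, A (ocons b0 b i).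
    by move=> k; rewrite /ocons; case: unlift => // ; exact: AN (AM _ _ vA gA).
  have -> : \sum_i \sum_j star (ocons b0 b i) * G i j * ocons b0 b j =
      \sum_i \sum_j star (b i) * S i j * b j.
    rewrite big_ord_recl big_ord_recl !ocons0.
    have -> : \sum_(i < m) star b0 * G ord0 (lift ord0 i) * ocons b0 b (lift ord0 i)
        = - (star g * g).
      transitivity (star b0 * s * g); last first.
        by rewrite /b0 starN starM sv !mulNr -[_ * v * s]mulrA vsE mulr1.
      rewrite mulr_sumr; apply: eq_bigr => j _; rewrite G0S oconsS; ncring.
    have -> : \sum_(i < m) \sum_j star (ocons b0 b (lift ord0 i)) * G (lift ord0 i) j * ocons b0 b j
       = star g * s * b0 + \sum_i \sum_j star (b i) * G (lift ord0 i) (lift ord0 j) * b j.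
      rewrite star_sum !mulr_suml -big_split; apply: eq_bigr => i _ /=.
      rewrite big_ord_recl oconsS ocons0 GS0 (starM (gam i)); congr (_ + _); first by ncring.
      by apply: eq_bigr => j _; rewrite oconsS.
    have -> : star b0 * G ord0 ord0 * b0 = star g * g.
      rewrite /b0 starN starM sv -sE (_ : _ * - (v * g) = star g * (v * s) * (s * v) * g).
        by rewrite vsE svE; ncring.
      by ncring.
    have -> : star g * s * b0 = - (star g * g).
      rewrite /b0 (_ : _ * - (v * g) = - (star g * (s * v) * g)); last by ncring.
      by rewrite svE; ncring.
    rewrite subrr add0r addrC star_sum mulr_suml -sumrB; apply: eq_bigr => i _.
    rewrite mulr_sumr -sumrB; apply: eq_bigr => j _.
    by rewrite /S (starM (gam i)); ncring.
  rewrite [\sum_i star (ocons _ _ _) * _]big_ord_recl ocons0 => H.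
  have := psdD H (psdZ (ltW r0) (psd_starM b0)).
  under [\sum_(i < m) star (ocons _ _ _) * _]eq_bigr do rewrite oconsS.
  by rewrite scalerDr opprD addrA addrAC addrNK.
exists (ocons (ocons s gam) (fun k => ocons 0 (beta k))); split.
  by move=> k i; rewrite /ocons; case: unlift => [l|]; case: unlift.
move=> i j; rewrite big_ord_recl !ocons0.
under eq_bigr do rewrite !oconsS.
case: (unliftP ord0 i) => [i' ->|->]; case: (unliftP ord0 j) => [j' ->|->]; rewrite ?ocons0 ?oconsS.
- under eq_bigr do rewrite !oconsS.
  by rewrite -betaE /S; ncring.
- by rewrite big1 ?addr0 // => k _; rewrite ocons0 mulr0.
- by rewrite big1 ?addr0 ?G0S ?ss // => k _; rewrite ocons0 star0 mul0r.
- by rewrite big1 ?addr0 ?ss ?sE // => k _; rewrite ocons0 star0 mul0r.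
Qed.

End Cholesky.

(** * A self-adjoint quasi-basis *)

Section QuasiBasis.
Variables (R : realType) (C : cstarAlgType R) (A : set C) (E : C -> C).
Hypotheses (hA : cstar_subalgebra A) (hE : conditional_expectation A E).

Lemma psd_norm_bound (v x : C) :
  psd ((cnorm v ^+ 2)%:c *: (star x * x) - star (v * x) * (v * x)).
Proof.
have : psd ((cnorm v ^+ 2)%:c *: 1 - star v * v).
  split; first by rewrite starB starZr star1 starM starK.
  by exists (cnorm v ^+ 2); rewrite opprB addrC subrK cnorm_starM.
move=> /(psd_conj x); rewrite mulrBr mulrBl -scalerAr -scalerAl mulr1.
by rewrite starM -!mulrA.
Qed.

Lemma psd_starD (p q : C) :
  psd (2%:c *: (star p * p) + 2%:c *: (star q * q) - star (p + q) * (p + q)).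
Proof.
have -> : 2%:c *: (star p * p) + 2%:c *: (star q * q) - star (p + q) * (p + q) =
   star (p - q) * (p - q).
  have two x : 2%:c *: x = x + x :> C.
    by rewrite (_ : 2 = 1 + 1 :> R) // rmorphD scalerDl scale1r.
  by rewrite !two starD starB; ncring.
exact: psd_starM.
Qed.

(** The Gram matrix E (star u_i * u_j) satisfies
sum_ij star v_i * E (star u_i * u_j) * E (v_j x) = x, so a factorisation of it
through its adjoint turns (u, v) into the required w.  It is only
semidefinite in general; adding star P * P, where P = 1 - q and q is the
idempotent matrix E (v_i u_j), does not change this sum, because P annihilates
the column of the E (v_j x), and makes the matrix bounded below. *)
Lemma exists_quasi_basis_star : finite_watatani_index E ->
  exists n (w : 'I_n -> C), quasi_basis_star E w.
Proof.
move=> [n [u [v uv]]].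
have [A0 AZ AD AB AN] := cstar_subalgebra_closure hA.
have [A1 _ AM Astar _] := hA.
have EA := condE_mem hE.
have uvl x : \sum_i u i * E (v i * x) = x by have [] := uv x.
have uvr x : \sum_i star (v i) * E (star (u i) * x) = x.
  rewrite -[RHS]starK; have [_ ->] := uv (star x).
  rewrite star_sum; apply: eq_bigr => i _.
  by rewrite starM -(condE_star hA hE) starM starK.
pose P i j := (i == j)%:R - E (v i * u j).
have PA i j : A (P i j) by apply: AB => //; case: eqP.
pose G i j := E (star (u i) * u j) + \sum_k star (P k i) * P k j.
have sumA (F : 'I_n -> C) : (forall k, A (F k)) -> A (\sum_k F k).
  by move=> FA; apply: (big_ind A).
(* 1 / kap is the lower bound: b = y + z with y = P b and z_k = E (v_k x), where
   star z_k * z_k <= |v_k|^2 E (star x * x). *)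
pose kap := 2 + 2 * \sum_k cnorm (v k) ^+ 2.
have kap2 : 2 <= kap by rewrite lerDl mulr_ge0 // sumr_ge0 // => k _; rewrite sqr_ge0.
have kap0 : 0 < kap by apply: lt_le_trans kap2.
have [||||beta [betaA betaE]] := @cholesky R C A hA n G kap^-1.
- by rewrite invr_gt0.
- move=> i j; exact: AD (EA _) (sumA _ (fun k => AM _ _ (Astar _ (PA _ _)) (PA _ _))).
- move=> i j; rewrite starD -(condE_star hA hE) starM starK star_sum; congr (_ + _).
  by apply: eq_bigr => k _; rewrite starM starK.
- move=> b bA; pose x := \sum_j u j * b j; pose y k := b k - E (v k * x).
  have yE k : \sum_j P k j * b j = y k.
    under eq_bigr do rewrite mulrBl; rewrite sumrB; congr (_ - _).
      by rewrite (bigD1 k) //= eqxx mul1r big1 ?addr0 // => j /negPf kj; rewrite eq_sym kj mul0r.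
    rewrite /x mulr_sumr (condE_sum hA hE); apply: eq_bigr => j _.
    by rewrite mulrA -(condEMr hA hE) //.
  have -> : \sum_i \sum_j star (b i) * G i j * b j = E (star x * x) + \sum_k star (y k) * y k.
    transitivity (\sum_i \sum_j (star (b i) * E (star (u i) * u j) * b j +
        \sum_k star (P k i * b i) * (P k j * b j))).
      apply: eq_bigr => i _; apply: eq_bigr => j _; rewrite mulrDr mulrDl; congr (_ + _).
      by rewrite mulr_sumr mulr_suml; apply: eq_bigr => k _; rewrite starM !mulrA.
    under eq_bigr do rewrite big_split; rewrite big_split; congr (_ + _).
      rewrite /x star_sum mulr_suml (condE_sum hA hE); apply: eq_bigr => i _.
      rewrite mulr_sumr (condE_sum hA hE); apply: eq_bigr => j _.
      rewrite starM (_ : _ * (u j * b j) = star (b i) * (star (u i) * u j) * b j); last ncring.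
      by rewrite (condEMr hA hE _ (bA j)) (condEMl hA hE _ (Astar _ (bA i))).
    under eq_bigr do rewrite exchange_big /=; rewrite exchange_big; apply: eq_bigr => k _.
    rewrite -yE star_sum mulr_suml; apply: eq_bigr => i _.
    by rewrite mulr_sumr.
  pose z k := E (v k * x).
  have zP k : psd ((cnorm (v k) ^+ 2)%:c *: E (star x * x) - star (z k) * z k).
    have := psdD (condE_psd hE (psd_norm_bound (v k) x)) (condE_schwarz hA hE (v k * x)).
    by rewrite (condEB hA hE) (condEZ hA hE) addrA addrNK.
  have yz k : b k = y k + z k by rewrite subrK.
  have EP : psd (E (star x * x)) by apply: (condE_psd hE); exact: psd_starM.
  have yP : psd (\sum_k star (y k) * y k) by apply: psd_sum => k _; exact: psd_starM.
  pose t := \sum_k cnorm (v k) ^+ 2; pose Ex := E (star x * x).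
  pose Y := \sum_k star (y k) * y k; pose Z := \sum_k star (z k) * z k.
  have P1 : psd (t%:c *: Ex - Z).
    rewrite /t rmorph_sum scaler_suml -sumrB.
    by apply: psd_sum => k _; exact: zP.
  have P2 : psd (2%:c *: Y + 2%:c *: Z - \sum_k star (b k) * b k).
    rewrite !scaler_sumr -big_split -sumrB; apply: psd_sum => k _ /=.
    by rewrite yz; exact: psd_starD.
  have -> : Ex + Y - (kap^-1)%:c *: \sum_k star (b k) * b k = (kap^-1)%:c *:
     (2%:c *: (t%:c *: Ex - Z) + (2%:c *: Y + 2%:c *: Z - \sum_k star (b k) * b k)
      + 2%:c *: Ex + (2 * t)%:c *: Y).
    have -> : 2%:c *: (t%:c *: Ex - Z) + (2%:c *: Y + 2%:c *: Z - \sum_k star (b k) * b k)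
      + 2%:c *: Ex + (2 * t)%:c *: Y = kap%:c *: (Ex + Y) - \sum_k star (b k) * b k.
      have kE : kap%:c = 2%:c + 2%:c * t%:c by rewrite -rmorphM -rmorphD.
      have -> : (2 * t)%:c = 2%:c * t%:c by rewrite -rmorphM.
      rewrite kE; move: (2%:c) (t%:c) => p q.
      pose sm (c : R[i]) (x : C) : C := c *: x.
      have smE c c' : c *: c' = sm c c' by [].
      by rewrite !scalerDl -!scalerA !scalerDr !scalerN !smE; ncring.
    by rewrite scalerBr scalerA -rmorphM mulVf ?gt_eqF // scale1r.
  have t0 : 0 <= t by apply: sumr_ge0 => k _; rewrite sqr_ge0.
  apply: psdZ; first by rewrite invr_ge0 ltW.
  do !apply: psdD => //; apply: psdZ => //.
  by rewrite mulr_ge0.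
exists n, (fun k => \sum_i star (v i) * star (beta k i)) => x.
have key : \sum_i \sum_j star (v i) * G i j * E (v j * x) = x.
  transitivity (\sum_i star (v i) * E (star (u i) * x)); last exact: uvr.
  apply: eq_bigr => i _.
  transitivity (\sum_j (star (v i) * E (star (u i) * (u j * E (v j * x))) +
    \sum_k star (v i) * star (P k i) * (P k j * E (v j * x)))).
    apply: eq_bigr => j _; rewrite mulrDr mulrDl; congr (_ + _).
      by rewrite -mulrA -(condEMr hA hE _ (EA _)) -!mulrA.
    by rewrite mulr_sumr mulr_suml; apply: eq_bigr => k _; rewrite !mulrA.
  rewrite big_split /= -mulr_sumr -(condE_sum hA hE) -mulr_sumr uvl.
  rewrite exchange_big /= big1 ?addr0 // => k _.
  rewrite -mulr_sumr; under eq_bigr do rewrite mulrBl; rewrite sumrB.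
  rewrite (bigD1 k) //= eqxx mul1r big1 ?addr0; last first.
    by move=> j /negPf kj; rewrite eq_sym kj mul0r.
  under eq_bigr do rewrite -(condEMr hA hE) // -mulrA.
  by rewrite -(condE_sum hA hE) -mulr_sumr uvl subrr mulr0.
rewrite -[LHS]key.
under eq_bigr => i _ do under eq_bigr => j _ do
  rewrite betaE mulr_sumr mulr_suml.
under eq_bigr => i _ do rewrite exchange_big /=.
rewrite exchange_big; apply: eq_bigr => k _ /=.
rewrite mulr_suml; apply: eq_bigr => i _.
rewrite star_sum mulr_suml (condE_sum hA hE) mulr_sumr; apply: eq_bigr => j _.
by rewrite starM !starK -(mulrA (beta k j)) (condEMl hA hE _ (betaA _ _)) !mulrA.
Qed.

End QuasiBasis.

(** * The space of bimodule maps and its dimension *)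

Section Bimodule.
Variables (R : realType) (C : cstarAlgType R) (A : set C) (E : C -> C).
Hypotheses (hA : cstar_subalgebra A) (hirr : irreducible A).
Hypotheses (hE : conditional_expectation A E) (hfaith : faithful E).
Variables (n : nat) (w : 'I_n -> C).
Hypothesis hw : quasi_basis_star E w.

Lemma qb_left x : \sum_r w r * E (star (w r) * x) = x.
Proof. by rewrite -hw. Qed.

Lemma qb_right x : \sum_r E (x * w r) * star (w r) = x.
Proof.
rewrite -[RHS]starK (hw (star x)) star_sum; apply: eq_bigr => r _.
by rewrite starM -(condE_star hA hE) starM !starK.
Qed.

Definition balanced (f : C -> C -> C) : Prop :=
  [/\ forall x x' y, f (x + x') y = f x y + f x' y,
      forall x y y', f x (y + y') = f x y + f x y'
    & forall a x y, A a -> f (x * a) y = f x (a * y)].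

Lemma balanced_suml f (hf : balanced f) I (s : seq I) P (F : I -> C) y :
  f (\sum_(i <- s | P i) F i) y = \sum_(i <- s | P i) f (F i) y.
Proof.
have [fl _ _] := hf; apply: (big_morph (f^~ y)) => [x x'|]; first exact: fl.
by have := fl 0 0 y; rewrite addr0 => /eqP; rewrite -subr_eq0 opprD addNKr oppr_eq0 => /eqP.
Qed.

Lemma balanced_sumr f (hf : balanced f) I (s : seq I) P (F : I -> C) x :
  f x (\sum_(i <- s | P i) F i) = \sum_(i <- s | P i) f x (F i).
Proof.
have [_ fr _] := hf; apply: (big_morph (f x)) => [y y'|]; first exact: fr.
by have := fr x 0 0; rewrite addr0 => /eqP; rewrite -subr_eq0 opprD addNKr oppr_eq0 => /eqP.
Qed.

(** The element sum_r w_r (x) star w_r of the tensor square of C over A is central: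
expanding c * w_r in the quasi-basis moves c across the tensor sign. *)
Lemma casimir f c : balanced f ->
  \sum_r f (c * w r) (star (w r)) = \sum_r f (w r) (star (w r) * c).
Proof.
move=> hf; have [_ _ fb] := hf; have EA := condE_mem hE.
transitivity (\sum_r \sum_s f (w s) (E (star (w s) * c * w r) * star (w r))).
  apply: eq_bigr => r _; rewrite -[c * w r]qb_left (balanced_suml hf).
  by apply: eq_bigr => s _; rewrite fb // mulrA.
rewrite exchange_big; apply: eq_bigr => s _ /=.
by rewrite -(balanced_sumr hf) qb_right.
Qed.

Definition scal (z : C) : R[i] := xget 0 [set c | z = c *: 1].

Lemma scalE (c : R[i]) : scal (c *: 1) = c.
Proof. by apply: xget_unique => // d /scal_inj. Qed.

Lemma scal_central z : (forall a, A a -> a * z = z * a) -> z = scal z *: 1.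
Proof.
move=> za; have : commutant A z by [].
by rewrite hirr => -[c ->]; rewrite scalE.
Qed.

Lemma casimir_scalar f : balanced f -> (forall a x y, A a -> f (a * x) y = a * f x y) ->
  (forall a x y, A a -> f x (y * a) = f x y * a) ->
  \sum_r f (w r) (star (w r)) = scal (\sum_r f (w r) (star (w r))) *: 1.
Proof.
move=> hf fl fr; apply: scal_central => a Aa.
rewrite mulr_sumr mulr_suml -[RHS](eq_bigr _ (fun r _ => fr a (w r) (star (w r)) Aa)).
by rewrite -(casimir _ hf); apply: eq_bigr => r _; rewrite fl.
Qed.

Definition bimod (T : C -> C) : Prop :=
  [/\ forall (c : R[i]) x y, T (c *: x + y) = c *: T x + T y,
      forall a x, A a -> T (a * x) = a * T x
    & forall a x, A a -> T (x * a) = T x * a].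

Lemma bimodD T (hT : bimod T) x y : T (x + y) = T x + T y.
Proof. by case: hT => l _ _; rewrite -[x]scale1r l !scale1r. Qed.

Lemma bimod0 T (hT : bimod T) : T 0 = 0.
Proof.
by have /eqP := bimodD hT 0 0; rewrite addr0 -subr_eq0 opprD addNKr oppr_eq0 => /eqP.
Qed.

Lemma bimodZ T (hT : bimod T) c x : T (c *: x) = c *: T x.
Proof. by case: (hT) => l _ _; rewrite -[_ *: _]addr0 l (bimod0 hT) addr0. Qed.

Lemma bimod_sum T (hT : bimod T) I (s : seq I) P (F : I -> C) :
  T (\sum_(i <- s | P i) F i) = \sum_(i <- s | P i) T (F i).
Proof. exact: (big_morph T (bimodD hT) (bimod0 hT)). Qed.

Lemma bimodMl T (hT : bimod T) a x : A a -> T (a * x) = a * T x.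
Proof. by move=> Aa; case: hT => _ H _; exact: H. Qed.

Lemma bimodMr T (hT : bimod T) a x : A a -> T (x * a) = T x * a.
Proof. by move=> Aa; case: hT => _ _ H; exact: H. Qed.

Lemma bimod_expand T (hT : bimod T) x : T x = \sum_r T (w r) * E (star (w r) * x).
Proof.
rewrite -{1}[x]qb_left (bimod_sum hT); apply: eq_bigr => r _.
by rewrite (bimodMr hT) //; exact: condE_mem hE _.
Qed.

Lemma bimodE : bimod E.
Proof.
by split=> [c x y|a x Aa|a x Aa];
  [exact: condE_linear hE _ _ _|exact: (condEMl hA hE)|exact: (condEMr hA hE)].
Qed.

Lemma bimod_id : bimod id.
Proof. by split. Qed.

Lemma bimod_comp T S : bimod T -> bimod S -> bimod (T \o S).
Proof.
move=> hT hS; split=> [c x y|a x Aa|a x Aa] /=.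
- by rewrite (bimodD hS) (bimodZ hS) (bimodD hT) (bimodZ hT).
- by rewrite (bimodMl hS) // (bimodMl hT).
- by rewrite (bimodMr hS) // (bimodMr hT).
Qed.

Lemma bimod_lin k (c : 'I_k -> R[i]) (T : 'I_k -> C -> C) : (forall j, bimod (T j)) ->
  bimod (fun x => \sum_j c j *: T j x).
Proof.
move=> hT; split=> [b x y|a x Aa|a x Aa].
- rewrite scaler_sumr -big_split; apply: eq_bigr => j _ /=.
  by rewrite (bimodD (hT j)) (bimodZ (hT j)) scalerDr !scalerA mulrC.
- by rewrite mulr_sumr; apply: eq_bigr => j _; rewrite (bimodMl (hT j)) // scalerAr.
- by rewrite mulr_suml; apply: eq_bigr => j _; rewrite (bimodMr (hT j)) // scalerAl.
Qed.

Lemma bimodBf T S : bimod T -> bimod S -> bimod (fun x => T x - S x).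
Proof.
move=> hT hS; split=> [c x y|a x Aa|a x Aa].
- by rewrite (bimodD hT) (bimodD hS) (bimodZ hT) (bimodZ hS) opprD addrACA scalerBr.
- by rewrite (bimodMl hT) // (bimodMl hS) // mulrBr.
- by rewrite (bimodMr hT) // (bimodMr hS) // mulrBl.
Qed.

Lemma bimodZf T c : bimod T -> bimod (fun x => c *: T x).
Proof.
move=> hT; split=> [d x y|a x Aa|a x Aa].
- by rewrite (bimodD hT) (bimodZ hT) scalerDr !scalerA mulrC.
- by rewrite (bimodMl hT) // scalerAr.
- by rewrite (bimodMr hT) // scalerAl.
Qed.

Definition bar (T : C -> C) : C -> C := fun x => star (T (star x)).

Lemma bimod_bar T : bimod T -> bimod (bar T).
Proof.
have [_ _ _ Astar _] := hA.
move=> hT; split=> [c x y|a x Aa|a x Aa]; rewrite /bar.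
- by rewrite starD (bimodD hT) starD starZ (bimodZ hT) starZ conjCK.
- by rewrite starM (bimodMr hT) ?starM ?starK //; exact: Astar.
- by rewrite starM (bimodMl hT) ?starM ?starK //; exact: Astar.
Qed.

(** The Hilbert-Schmidt scalar product of bimodule maps; its values are scalars by
casimir_scalar. *)
Definition hs_form (T S : C -> C) : R[i] := scal (\sum_r T (w r) * star (S (w r))).

Lemma hs_formE T S : bimod T -> bimod S ->
  \sum_r T (w r) * star (S (w r)) = hs_form T S *: 1.
Proof.
have [_ _ _ Astar _] := hA.
move=> hT hS; pose f x y := T x * star (S (star y)).
have fE : \sum_r f (w r) (star (w r)) = \sum_r T (w r) * star (S (w r)).
  by apply: eq_bigr => r _; rewrite /f starK.
rewrite /hs_form -fE; apply: casimir_scalar.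
- split=> [x x' y|x y y'|a x y Aa]; rewrite /f.
  + by rewrite (bimodD hT) mulrDl.
  + by rewrite starD (bimodD hS) starD mulrDr.
  + by rewrite (bimodMr hT) // starM (bimodMr hS) ?starM ?starK ?mulrA //; exact: Astar.
- by move=> a x y Aa; rewrite /f (bimodMl hT) // mulrA.
- by move=> a x y Aa; rewrite /f starM (bimodMl hS) ?starM ?starK ?mulrA //; exact: Astar.
Qed.

Lemma hs_form_sum k (c : 'I_k -> R[i]) (T : 'I_k -> C -> C) S :
  (forall j, bimod (T j)) -> bimod S ->
  hs_form (fun x => \sum_j c j *: T j x) S = \sum_j c j * hs_form (T j) S.
Proof.
move=> hT hS; apply: (@scal_inj R C); rewrite -hs_formE //; last exact: bimod_lin.
rewrite scaler_suml; under [RHS]eq_bigr do rewrite -scalerA -hs_formE // scaler_sumr.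
rewrite exchange_big; apply: eq_bigr => r _ /=.
by rewrite mulr_suml; apply: eq_bigr => j _; rewrite scalerAl.
Qed.

Lemma hs_form_conj T S : bimod T -> bimod S -> hs_form S T = Num.conj (hs_form T S).
Proof.
move=> hT hS; apply: (@scal_inj R C); rewrite -hs_formE // -[1 in RHS](@star1 R C) -starZ -hs_formE //.
by rewrite star_sum; apply: eq_bigr => r _; rewrite starM starK.
Qed.

Lemma hs_formB T T' S : bimod T -> bimod T' -> bimod S ->
  hs_form (fun x => T x - T' x) S = hs_form T S - hs_form T' S.
Proof.
move=> hT hT' hS; apply: (@scal_inj R C); rewrite -hs_formE //; last exact: bimodBf.
rewrite scalerBl -!hs_formE // -sumrB; apply: eq_bigr => r _.
by rewrite mulrBl.
Qed.

Lemma hs_formZ T S c : bimod T -> bimod S -> hs_form (fun x => c *: T x) S = c * hs_form T S.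
Proof.
move=> hT hS; apply: (@scal_inj R C); rewrite -hs_formE //; last exact: bimodZf.
rewrite -scalerA -hs_formE // scaler_sumr; apply: eq_bigr => r _.
by rewrite scalerAl.
Qed.

Lemma psd_starMr (x : C) : psd (x * star x).
Proof. by rewrite -{1}[x]starK; exact: psd_starM. Qed.

Lemma hs_form_ge0 T : bimod T -> 0 <= hs_form T T.
Proof.
move=> hT; apply: (@psd_scalar R C); rewrite -hs_formE //.
by apply: psd_sum => r _; exact: psd_starMr.
Qed.

Lemma hs_form_eq0 T : bimod T -> hs_form T T = 0 -> forall x, T x = 0.
Proof.
move=> hT T0; have := hs_formE hT hT; rewrite T0 scale0r => s0.
have Tw r : T (w r) = 0.
  rewrite -[T (w r)]starK; rewrite (_ : star (T (w r)) = 0) ?star0 //.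
  apply: star_mul_eq0; rewrite starK; apply: psd_antisym; first exact: psd_starMr.
  move: s0; rewrite (bigD1 r) //= => /eqP; rewrite addrC addr_eq0 => /eqP <-.
  by apply: psd_sum => i _; exact: psd_starMr.
by move=> x; rewrite bimod_expand // big1 // => r _; rewrite Tw mul0r.
Qed.

Lemma hs_formZr T S c : bimod T -> bimod S ->
  hs_form T (fun x => c *: S x) = Num.conj c * hs_form T S.
Proof.
move=> hT hS; rewrite hs_form_conj ?hs_formZ //; last exact: bimodZf.
by rewrite rmorphM /= -hs_form_conj.
Qed.

Lemma hs_formZZ T c : bimod T ->
  hs_form (fun x => c *: T x) (fun x => c *: T x) = c * Num.conj c * hs_form T T.
Proof. by move=> hT; rewrite hs_formZ ?hs_formZr ?mulrA //; exact: bimodZf. Qed.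

Definition orthonormal_maps k (T : 'I_k -> C -> C) : Prop :=
  (forall j, bimod (T j)) /\ forall i j, hs_form (T i) (T j) = (i == j)%:R.

(** In the row space of C the vectors (T_j (w_r))_r are orthonormal, and the coefficients
of the row a = (star (E (star w_r * x)))_r against them are star (T_j x).  The claim is
the positivity of the squared length of a - b, with b the projection of a. *)
Lemma bessel k (T : 'I_k -> C -> C) x : orthonormal_maps T ->
  psd (E (star x * x) - \sum_j star (T j x) * T j x).
Proof.
move=> [hT oT]; pose a r := star (E (star (w r) * x)).
pose b r := \sum_j star (T j x) * T j (w r).
pose Bx := \sum_j star (T j x) * T j x.
have ba : \sum_r b r * star (a r) = Bx.
  under eq_bigr do rewrite mulr_suml; rewrite exchange_big; apply: eq_bigr => j _ /=.
  rewrite [X in _ = _ * X](bimod_expand (hT j)) mulr_sumr; apply: eq_bigr => r _.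
  by rewrite /a starK -mulrA.
have ab : \sum_r a r * star (b r) = Bx.
  transitivity (star (\sum_r b r * star (a r))).
    by rewrite star_sum; apply: eq_bigr => r _; rewrite starM starK.
  by rewrite ba star_sum; apply: eq_bigr => j _; rewrite starM starK.
have aa : \sum_r a r * star (a r) = E (star x * x).
  rewrite -[X in _ = E (_ * X)]qb_left mulr_sumr (condE_sum hA hE); apply: eq_bigr => r _.
  rewrite mulrA (condEMr hA hE _ (condE_mem hE _)) /a starK; congr (_ * _).
  by rewrite -(condE_star hA hE) starM starK.
have bb : \sum_r b r * star (b r) = Bx.
  transitivity (\sum_j \sum_l star (T j x) * (\sum_r T j (w r) * star (T l (w r))) * T l x).
    rewrite [LHS](eq_bigr (fun r => \sum_j \sum_l star (T j x) * (T j (w r) * star (T l (w r))) * T l x)).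
      rewrite exchange_big; apply: eq_bigr => j _ /=.
      rewrite exchange_big; apply: eq_bigr => l _ /=.
      by rewrite -mulr_suml -mulr_sumr.
    move=> s _; rewrite mulr_suml; apply: eq_bigr => j _.
    rewrite star_sum mulr_sumr; apply: eq_bigr => l _.
    by rewrite starM starK !mulrA.
  apply: eq_bigr => j _; rewrite (bigD1 j) //= [X in _ + X]big1 ?addr0 => [|l lj].
    by rewrite hs_formE // oT eqxx scale1r mulr1.
  by rewrite hs_formE // oT eq_sym (negPf lj) scale0r mulr0 mul0r.
have -> : E (star x * x) - Bx = \sum_r (a r - b r) * star (a r - b r).
  transitivity (\sum_r a r * star (a r) - \sum_r a r * star (b r)
     - (\sum_r b r * star (a r) - \sum_r b r * star (b r))).
    by rewrite aa ab ba bb subrr subr0.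
  by rewrite -!sumrB; apply: eq_bigr => r _; rewrite starB; ncring.
by apply: psd_sum => r _; exact: psd_starMr.
Qed.

(** Bessel's inequality summed over x = star w_r; hs_form id id is the index. *)
Lemma sum_hs_form_bar k (T : 'I_k -> C -> C) : orthonormal_maps T ->
  \sum_j hs_form (bar (T j)) (bar (T j)) <= hs_form id id.
Proof.
move=> oT; have [hT _] := oT; rewrite -subr_ge0; apply: (@psd_scalar R C).
rewrite scalerBl -(hs_formE bimod_id bimod_id) scaler_suml.
have -> : \sum_r id (w r) * star (id (w r)) = \sum_r E (w r * star (w r)).
  by rewrite -(condE_sum hA hE) [in RHS](hs_formE bimod_id bimod_id) (condEZ hA hE)
             (condE1 hA hE) (hs_formE bimod_id bimod_id).
have -> : \sum_j hs_form (bar (T j)) (bar (T j)) *: (1 : C) =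
    \sum_j \sum_r bar (T j) (w r) * star (bar (T j) (w r)).
  by apply: eq_bigr => j _; rewrite (hs_formE (bimod_bar (hT j)) (bimod_bar (hT j))).
rewrite exchange_big -sumrB; apply: psd_sum => r _ /=.
have := bessel (star (w r)) oT; rewrite starK /bar.
rewrite [X in _ -> psd (_ - X)](eq_bigr (fun j => star (T j (star (w r))) * T j (star (w r)))) //.
by move=> j _; rewrite starK.
Qed.

Lemma normalize T : bimod T -> hs_form T T != 0 ->
  exists2 c : R[i], c != 0 & hs_form (fun x => c *: T x) (fun x => c *: T x) = 1.
Proof.
move=> hT T0; have p0 := hs_form_ge0 hT; exists (sqrtC (hs_form T T))^-1.
  by rewrite invr_eq0 sqrtC_eq0.
rewrite hs_formZZ // geC0_conj ?invr_ge0 ?sqrtC_ge0 // -invfM -expr2 sqrtCK.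
by rewrite mulVf.
Qed.

Lemma barK T : bar (bar T) = T.
Proof. by apply/funext => x; rewrite /bar !starK. Qed.

(** The case of one vector, proportional to bar T, in sum_hs_form_bar. *)
Lemma hs_form_le_bar T : bimod T -> hs_form T T <= hs_form id id * hs_form (bar T) (bar T).
Proof.
move=> hT; have hb := bimod_bar hT.
have [b0|b0] := eqVneq (hs_form (bar T) (bar T)) 0.
  have T0 x : T x = 0.
    by rewrite -[T]barK /bar [star (T _)](hs_form_eq0 hb b0) star0.
  rewrite b0 mulr0 (_ : hs_form T T = 0) //; apply: (@scal_inj R C); rewrite -hs_formE // scale0r.
  by rewrite big1 // => r _; rewrite T0 mul0r.
have [c c0 c1] := normalize hb b0; pose S := fun x => c *: bar T x.
have hS : bimod S by exact: bimodZf.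
have : orthonormal_maps (fun _ : 'I_1 => S).
  by split=> // i j; rewrite c1 !ord1.
move=> /sum_hs_form_bar; rewrite big_ord1.
have -> : bar S = fun x => Num.conj c *: T x.
  by apply/funext => x; rewrite /bar /S starZ -[in RHS](barK T).
rewrite (hs_formZZ _ hT) conjCK [_ * c]mulrC.
move: c1; rewrite (hs_formZZ _ hb) => cc.
have cp : 0 < c * Num.conj c by rewrite -normCK exprn_gt0 // normr_gt0.
rewrite -(ler_pM2r (x := hs_form (bar T) (bar T))); last by rewrite lt_def b0 hs_form_ge0.
by rewrite mulrAC cc mul1r.
Qed.

(** A crude bound, valid before M is known to be finite-dimensional: each T_j has
norm 1, so by hs_form_le_bar the sum in sum_hs_form_bar is at least k divided by the
index. *)
Lemma orthonormal_bound k (T : 'I_k -> C -> C) : orthonormal_maps T ->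
  k%:R <= hs_form id id ^+ 2.
Proof.
move=> oT; have [hT o1] := oT.
have l0 := hs_form_ge0 bimod_id.
apply: (@le_trans _ _ (hs_form id id * \sum_j hs_form (bar (T j)) (bar (T j)))).
  rewrite mulr_sumr -[k in k%:R]card_ord -sum1_card natr_sum; apply: ler_sum => j _.
  by have := hs_form_le_bar (hT j); rewrite o1 eqxx.
by rewrite expr2 ler_wpM2l // sum_hs_form_bar.
Qed.

Lemma orthonormal_cons k T0 (T : 'I_k -> C -> C) :
  orthonormal_maps (ocons T0 T) <->
  [/\ bimod T0, hs_form T0 T0 = 1, forall j, hs_form T0 (T j) = 0 & orthonormal_maps T].
Proof.
split=> [[hT oT]|[h0 h1 h2 [hT oT]]].
  have h0 : bimod T0 by have := hT ord0; rewrite ocons0.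
  have hS j : bimod (T j) by have := hT (lift ord0 j); rewrite oconsS.
  split=> //; first by have := oT ord0 ord0; rewrite ocons0 eqxx.
    by move=> j; have := oT ord0 (lift ord0 j); rewrite ocons0 oconsS (negPf (neq_lift _ _)).
  by split=> // i j; have := oT (lift ord0 i) (lift ord0 j); rewrite !oconsS (inj_eq lift_inj).
split=> [j|i j]; first by rewrite /ocons; case: unlift.
case: (unliftP ord0 i) => [i' ->|->]; case: (unliftP ord0 j) => [j' ->|->]; rewrite ?ocons0 ?oconsS.
- by rewrite oT (inj_eq lift_inj).
- by rewrite hs_form_conj // h2 conjC0 eq_sym (negPf (neq_lift _ _)).
- by rewrite h2 (negPf (neq_lift _ _)).
- by rewrite h1 eqxx.
Qed.

Definition spanning k (T : 'I_k -> C -> C) : Prop :=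
  forall S, bimod S -> S = fun x => \sum_j hs_form S (T j) *: T j x.

Lemma hs_form_EE : hs_form E E = 1.
Proof.
apply: (@scal_inj R C); rewrite -(hs_formE bimodE bimodE) scale1r.
rewrite -[RHS](condE1 hA hE) -[X in _ = E X]qb_left (condE_sum hA hE).
apply: eq_bigr => r _; rewrite (condEMr hA hE _ (condE_mem hE _)) mulr1.
by rewrite (condE_star hA hE).
Qed.

(** A maximal orthonormal family spans M.  It is made to start with E because the
expectations to be counted all have coordinate 1 along E. *)
Lemma exists_orthonormal_basis : exists k (T : 'I_k -> C -> C),
  orthonormal_maps (ocons E T) /\ spanning (ocons E T).
Proof.
pose P k := `[< exists T : 'I_k -> C -> C, orthonormal_maps (ocons E T) >].
have exP : exists k, P k.
  exists 0%N; apply/asboolP; exists (fun _ _ => 0); apply/orthonormal_cons.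
  by split; [exact: bimodE|exact: hs_form_EE|case|split; case].
have [N PN] : exists N, forall k, P k -> (k <= N)%N.
  have l0 := hs_form_ge0 bimod_id.
  pose l := complex.Re (hs_form id id ^+ 2).
  have lE : hs_form id id ^+ 2 = l%:c.
    by rewrite /l RRe_real // realE exprn_ge0.
  exists (Num.bound l) => k /asboolP[T /orthonormal_bound].
  rewrite lE -[_%:R](rmorph_nat (real_complex R)) lecR => kl.
  have l1 : 0 <= l by apply: le_trans kl.
  rewrite -(ler_nat R) ltW //; apply: le_lt_trans (archi_boundP l1).
  by apply: le_trans kl; rewrite ler_nat.
have [k /asboolP[T oT] kmax] := ex_maxnP exP PN.
exists k, T; split=> // S hS; pose T' := ocons E T.
have [hT' o1] : orthonormal_maps T' by [].
pose p := fun x => \sum_j hs_form S (T' j) *: T' j x.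
have hp : bimod p by exact: bimod_lin.
pose D := fun x => S x - p x.
have hD : bimod D by exact: bimodBf.
have DT j : hs_form D (T' j) = 0.
  rewrite hs_formB // /p hs_form_sum // (bigD1 j) //= o1 eqxx mulr1 big1 ?addr0 ?subrr // => l lj.
  by rewrite o1 (negPf lj) mulr0.
have [D0|D0] := eqVneq (hs_form D D) 0.
  by apply/funext => x; apply/eqP; rewrite -subr_eq0; apply/eqP; exact: hs_form_eq0 hD D0 x.
have [c c0 c1] := normalize hD D0; pose D' := fun x => c *: D x.
have hD' : bimod D' by exact: bimodZf.
have DT' j : hs_form D' (T' j) = 0 by rewrite hs_formZ // DT mulr0.
have /kmax : P k.+1; last by rewrite ltnn.
apply/asboolP; exists (ocons D' T); move/orthonormal_cons: oT => [hE' e1 eT oT].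
apply/orthonormal_cons; split=> //.
  move=> j; rewrite /ocons; case: unlift => //.
  by have := DT' ord0; rewrite /T' ocons0 => De; rewrite hs_form_conj // De conjC0.
apply/orthonormal_cons; split=> // j.
by have := DT' (lift ord0 j); rewrite /T' oconsS.
Qed.

(** The matrix L of the antilinear involution bar satisfies conj L * L = 1.  So k is
the trace of conj L * L, and the inequality |L_jl - L_lj|^2 >= 0, summed, bounds it by
sum |L_jl|^2. *)
Theorem orthonormal_basis_card k (T : 'I_k -> C -> C) :
  orthonormal_maps T -> spanning T -> k%:R <= hs_form id id.
Proof.
move=> oT sT; have [hT o1] := oT; apply: le_trans (sum_hs_form_bar oT).
pose L i j := hs_form (bar (T i)) (T j).
have hb j : bimod (bar (T j)) by exact: bimod_bar.
have bE j : hs_form (bar (T j)) (bar (T j)) = \sum_l L j l * Num.conj (L j l).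
  rewrite {1}(sT _ (hb j)) hs_form_sum //; apply: eq_bigr => l _.
  by rewrite [hs_form (T l) _]hs_form_conj.
have dE j : 1 = \sum_l Num.conj (L j l) * L l j.
  have -> : 1 = hs_form (T j) (T j) by rewrite o1 eqxx.
  rewrite -[T j in X in hs_form X]barK.
  have -> : bar (bar (T j)) = fun x => \sum_l Num.conj (L j l) *: bar (T l) x.
    rewrite {1}/bar {1}(sT _ (hb j)); apply/funext => x.
    by rewrite star_sum; apply: eq_bigr => l _; rewrite starZ.
  by rewrite hs_form_sum.
pose S1 := \sum_j \sum_l L j l * Num.conj (L j l).
under [X in _ <= X]eq_bigr do rewrite bE.
have kE : k%:R = \sum_j \sum_l Num.conj (L j l) * L l j.
  under eq_bigr do rewrite -dE.
  by rewrite -[k in LHS]card_ord -sum1_card natr_sum.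
have S1' : S1 = \sum_j \sum_l L l j * Num.conj (L l j) by rewrite /S1 exchange_big.
have kE' : k%:R = \sum_j \sum_l L j l * Num.conj (L l j).
  by rewrite kE exchange_big; apply: eq_bigr => j _; apply: eq_bigr => l _; rewrite mulrC.
have : 0 <= \sum_j \sum_l (L j l - L l j) * Num.conj (L j l - L l j).
  apply: sumr_ge0 => j _; apply: sumr_ge0 => l _.
  by rewrite -normCK exprn_ge0.
have -> : \sum_j \sum_l (L j l - L l j) * Num.conj (L j l - L l j) =
    (S1 + S1) - (k%:R + k%:R).
  rewrite {2}S1' {1}kE' kE /S1 -!big_split -sumrB; apply: eq_bigr => j _ /=.
  rewrite -!big_split -sumrB; apply: eq_bigr => l _ /=.
  by rewrite rmorphB /=; ring.
by rewrite subr_ge0 -/S1 -!mulr2n lerMn2r.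
Qed.

End Bimodule.

(** * Expectations onto intermediate algebras *)

Section Intermediate.
Variables (R : realType) (C : cstarAlgType R) (A : set C) (E : C -> C).
Hypotheses (hA : cstar_subalgebra A) (hirr : irreducible A).
Hypotheses (hE : conditional_expectation A E) (hfaith : faithful E).
Variables (n : nat) (w : 'I_n -> C).
Hypothesis hw : quasi_basis_star E w.

Local Notation bimod := (bimod A).
Local Notation hs_form := (hs_form w).

(** The product induced on M by the multiplication and the comultiplication
x |-> sum_r x w_r (x) star w_r of C. *)
Definition convol (T S : C -> C) : C -> C := fun x => \sum_r T (x * w r) * S (star (w r)).

Definition btrace (T : C -> C) : R[i] := scal (\sum_r w r * T (star (w r))).

Lemma btraceE T : bimod T -> \sum_r w r * T (star (w r)) = btrace T *: 1.
Proof.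
move=> hT; rewrite /btrace.
apply: (casimir_scalar hA hirr hE hw (f := fun x y => x * T y)).
- split=> [x x' y|x y y'|a x y Aa]; first by rewrite mulrDl.
  + by rewrite (bimodD hT) mulrDr.
  + by rewrite (bimodMl hT) // mulrA.
- by move=> a x y Aa; rewrite mulrA.
- by move=> a x y Aa; rewrite (bimodMr hT) // mulrA.
Qed.

Lemma btraceE' T : bimod T -> \sum_r T (w r) * star (w r) =
  scal (\sum_r T (w r) * star (w r)) *: 1.
Proof.
move=> hT; apply: (casimir_scalar hA hirr hE hw (f := fun x y => T x * y)).
- split=> [x x' y|x y y'|a x y Aa]; last by rewrite (bimodMr hT) // mulrA.
  + by rewrite (bimodD hT) mulrDl.
  + by rewrite mulrDr.
- by move=> a x y Aa; rewrite (bimodMl hT) // mulrA.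
- by move=> a x y Aa; rewrite mulrA.
Qed.

Lemma balancedM T S : bimod T -> bimod S -> balanced A (fun x y => T x * S y).
Proof.
move=> hT hS; split=> [x x' y|x y y'|a x y Aa].
- by rewrite (bimodD hT) mulrDl.
- by rewrite (bimodD hS) mulrDr.
- by rewrite (bimodMr hT) // (bimodMl hS) // mulrA.
Qed.

Lemma convolE T S : bimod T -> bimod S ->
  forall x, convol T S x = \sum_r T (w r) * S (star (w r) * x).
Proof. by move=> hT hS x; exact: (casimir hA hE hw x (balancedM hT hS)). Qed.

Lemma bimod_convol T S : bimod T -> bimod S -> bimod (convol T S).
Proof.
move=> hT hS; split=> [c x y|a x Aa|a x Aa].
- rewrite scaler_sumr -big_split; apply: eq_bigr => r _ /=.
  by rewrite mulrDl -scalerAl (bimodD hT) (bimodZ hT) mulrDl -scalerAl.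
- by rewrite mulr_sumr; apply: eq_bigr => r _; rewrite -mulrA (bimodMl hT) // mulrA.
- rewrite !convolE // mulr_suml; apply: eq_bigr => r _.
  by rewrite mulrA (bimodMr hS) // mulrA.
Qed.

Section Compatible.
Variables (B : set C) (F : C -> C).
Hypotheses (hB : cstar_subalgebra B) (hF : conditional_expectation B F).
Hypotheses (AB : A `<=` B) (EF : forall x, E x = E (F x)).

Let bimodE := bimodE hA hE.

Lemma bimod_expectation : bimod F.
Proof.
split=> [c x y|a x Aa|a x Aa]; first exact: condE_linear hF c x y.
- exact: condEMl hB hF _ _ (AB Aa).
- exact: condEMr hB hF _ _ (AB Aa).
Qed.
Let bF := bimod_expectation.

Lemma pairing_eq0 y : B y -> (forall b, B b -> E (y * b) = 0) -> y = 0.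
Proof.
have [_ _ _ Bstar _] := hB.
move=> /Bstar By /(_ _ By) Ey; rewrite -[y]starK (_ : star y = 0) ?star0 //.
by apply: hfaith; rewrite starK.
Qed.

Lemma pairing_eq0' y : B y -> (forall b, B b -> E (b * y) = 0) -> y = 0.
Proof.
have [_ _ _ Bstar _] := hB.
by move=> /Bstar By /(_ _ By) Ey; exact: hfaith.
Qed.

Lemma expectation_ker x b : F x = 0 -> B b -> E (x * b) = 0 /\ E (b * x) = 0.
Proof.
move=> Fx Bb; have E0 := condE0 hA hE.
rewrite [E (x * b)]EF [E (b * x)]EF (condEMr hB hF _ Bb) (condEMl hB hF _ Bb).
by rewrite Fx mul0r mulr0.
Qed.

(** Both sides lie in B, so they may be compared by pairing with B through E; the
expectations inside the sum can then be dropped, one by the factorisation of E and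
one by the B-linearity of F. *)
Lemma convol_expectation x : convol F F x = btrace F *: F x.
Proof.
have BF := condE_mem hF; have [_ BZ BD BB _] := cstar_subalgebra_closure hB.
have [_ _ BM _ _] := hB.
apply/eqP; rewrite -subr_eq0; apply/eqP; apply: pairing_eq0.
  apply: BB; last exact: BZ.
  apply: (big_ind B) => [||r _]; [|exact: BD|exact: BM].
  by have [] := cstar_subalgebra_closure hB.
move=> b Bb; rewrite mulrBl (condEB hA hE).
have -> : E (convol F F x * b) = E (x * (\sum_r w r * F (star (w r))) * b).
  rewrite mulr_suml mulr_sumr mulr_suml !(condE_sum hA hE); apply: eq_bigr => r _.
  by rewrite [RHS]EF (condEMr hB hF _ Bb) [x * (_ * _)]mulrA (condEMr hB hF _ (BF _)).
rewrite btraceE // -scalerAr mulr1 -!scalerAl !(condEZ hA hE) -scalerBr.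
by rewrite [E (x * b)]EF (condEMr hB hF _ Bb) subrr scaler0.
Qed.

Lemma btrace_expectation : btrace F = hs_form F F.
Proof.
apply: (@scal_inj R C); transitivity (convol F F 1); first by rewrite convol_expectation (condE1 hB hF).
rewrite -(hs_formE hA hirr hE hw bF bF); apply: eq_bigr => r _.
by rewrite mul1r (condE_star hB hF).
Qed.

Lemma btrace_expectation_neq0 : btrace F != 0.
Proof.
rewrite btrace_expectation; apply/eqP => /(hs_form_eq0 hA hirr hE hw bF) /(_ 1).
by rewrite (condE1 hB hF) => /eqP; rewrite oner_eq0.
Qed.

(** On B the map T takes values in the kernel of F, and modulo B the linearised
convolution equation writes (tr F) T b as b X + Y b with X and Y scalars in the kernel of
F, hence zero.  On the kernel of F the map T takes values in B, where both
convolutions vanish because they pair to zero with B. *)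
Lemma expectation_rigid T : bimod T -> (forall x, F (T x) + T (F x) = T x) ->
  (forall x, convol F T x + convol T F x = btrace T *: F x + btrace F *: T x) -> forall x, T x = 0.
Proof.
move=> bT FT cT; have BF := condE_mem hF; have c0 := btrace_expectation_neq0.
have [_ _ _ Bstar _] := hB.
have FF x : F (F x) = F x by exact: condE_id hF _ (BF x).
have FTF x : F (T (F x)) = 0.
  by have /eqP := FT (F x); rewrite FF -subr_eq0 addrK => /eqP.
have bTF : bimod (T \o F) by exact: bimod_comp.
have TF x : T (F x) = 0.
  have X0 : \sum_r F (w r) * T (F (star (w r))) = 0.
    have sc : \sum_r F (w r) * T (F (star (w r))) =
        scal (\sum_r F (w r) * T (F (star (w r)))) *: 1.
      apply: (casimir_scalar hA hirr hE hw (f := fun x y => F x * T (F y))).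
      - exact: balancedM bF bTF.
      - by move=> a u y Aa; rewrite (bimodMl bF) // mulrA.
      - by move=> a u y Aa; rewrite -[T (F (y * a))]/((T \o F) (y * a)) (bimodMr bTF) // mulrA.
    have : F (\sum_r F (w r) * T (F (star (w r)))) = 0.
      rewrite (condE_sum hB hF) big1 // => r _.
      by rewrite (condEMl hB hF _ (BF _)) FTF mulr0.
    by rewrite sc (condEZ hB hF) (condE1 hB hF).
  have Y0 : \sum_r T (F (w r)) * F (star (w r)) = 0.
    have sc : \sum_r T (F (w r)) * F (star (w r)) =
        scal (\sum_r T (F (w r)) * F (star (w r))) *: 1.
      apply: (casimir_scalar hA hirr hE hw (f := fun x y => T (F x) * F y)).
      - exact: balancedM bTF bF.
      - by move=> a u y Aa; rewrite -[T (F (a * u))]/((T \o F) (a * u)) (bimodMl bTF) // mulrA.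
      - by move=> a u y Aa; rewrite (bimodMr bF) // mulrA.
    have : F (\sum_r T (F (w r)) * F (star (w r))) = 0.
      rewrite (condE_sum hB hF) big1 // => r _.
      by rewrite (condEMr hB hF _ (BF _)) FTF mul0r.
    by rewrite sc (condEZ hB hF) (condE1 hB hF).
  pose b := F x; have Bb : B b by exact: BF.
  have Tker y : T y - F (T y) = T (F y) by rewrite -{1}[T y]FT addrAC subrr add0r.
  have Fb : F b = b by exact: FF.
  have := cT b => /(congr1 (fun z => z - F z)).
  have -> : btrace T *: F b + btrace F *: T b - F (btrace T *: F b + btrace F *: T b) = btrace F *: T b.
    by rewrite (condED hF) !(condEZ hB hF) FF /b FTF scaler0 addr0 addrAC subrr add0r.
  have -> : convol F T b + convol T F b - F (convol F T b + convol T F b) =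
      (convol F T b - F (convol F T b)) + (convol T F b - F (convol T F b)).
    by rewrite (condED hF) opprD addrACA.
  have -> : convol F T b - F (convol F T b) = b * \sum_r F (w r) * T (F (star (w r))).
    rewrite (condE_sum hB hF) -sumrB mulr_sumr; apply: eq_bigr => r _.
    rewrite (condEMl hB hF _ (BF _)) -mulrBr Tker.
    by rewrite (condEMl hB hF _ Bb) mulrA.
  have -> : convol T F b - F (convol T F b) = (\sum_r T (F (w r)) * F (star (w r))) * b.
    rewrite !convolE // (condE_sum hB hF) -sumrB mulr_suml; apply: eq_bigr => r _.
    rewrite (condEMr hB hF _ (BF _)) -mulrBl Tker.
    by rewrite (condEMr hB hF _ Bb) mulrA.
  rewrite X0 Y0 mulr0 mul0r addr0 => /esym/eqP.
  by rewrite scaler_eq0 (negPf c0) => /eqP.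
have FT' x : F (T x) = T x by have := FT x; rewrite TF addr0.
have BT x : B (T x) by rewrite -FT'.
have [B0 BZ BD BB _] := cstar_subalgebra_closure hB; have [_ _ BM _ _] := hB.
move=> x; rewrite -[x](subrK (F x)) (bimodD bT) TF addr0.
set y := x - F x; have Fy : F y = 0 by rewrite (condEB hB hF) FF subrr.
have P0 : convol F T y = 0.
  apply: pairing_eq0 => [|b Bb].
    by apply: (big_ind B) => // r _; exact: BM.
  have -> : E (convol F T y * b) = E (y * (\sum_r w r * T (star (w r))) * b).
    rewrite mulr_suml mulr_sumr mulr_suml !(condE_sum hA hE); apply: eq_bigr => r _.
    by rewrite [RHS]EF (condEMr hB hF _ Bb) [y * (_ * _)]mulrA (condEMr hB hF _ (BT _)).
  rewrite btraceE // -scalerAr mulr1 -scalerAl (condEZ hA hE).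
  by rewrite (expectation_ker Fy Bb).1 scaler0.
have Q0 : convol T F y = 0.
  apply: pairing_eq0' => [|b Bb].
    by apply: (big_ind B) => // r _; exact: BM.
  have -> : E (b * convol T F y) = E (b * (\sum_r T (w r) * star (w r)) * y).
    rewrite convolE // mulr_sumr mulr_sumr mulr_suml !(condE_sum hA hE); apply: eq_bigr => r _.
    by rewrite [RHS]EF -!mulrA (condEMl hB hF _ Bb) (condEMl hB hF _ (BT _)).
  rewrite btraceE' // -scalerAr mulr1 -scalerAl (condEZ hA hE).
  by rewrite (expectation_ker Fy Bb).2 scaler0.
have := cT y; rewrite P0 Q0 Fy scaler0 !add0r => /esym/eqP.
by rewrite scaler_eq0 (negPf c0) => /eqP.
Qed.

End Compatible.
End Intermediate.

(** * Counting intermediate algebras *)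

Section Counting.
Variables (R : realType) (C : cstarAlgType R) (A : set C) (E : C -> C).
Hypotheses (hA : cstar_subalgebra A) (hirr : irreducible A).
Hypotheses (hE : conditional_expectation A E) (hfaith : faithful E).
Variables (n : nat) (w : 'I_n -> C).
Hypothesis hw : quasi_basis_star E w.
Variables (k : nat) (T0 : 'I_k -> C -> C).

Local Notation bimod := (bimod A).
Local Notation hs_form := (hs_form w).
Local Notation T := (ocons E T0).
Hypotheses (oT : orthonormal_maps A w T) (sT : spanning A w T).

Let hT j : bimod (T j). Proof. by case: oT. Qed.
Let bE := bimodE hA hE.

Definition lincomb (x : 'I_k.+1 -> R[i]) : C -> C := fun z => \sum_a x a *: T a z.

Lemma bimod_comb x : bimod (lincomb x).
Proof. exact: bimod_lin. Qed.

Lemma hs_form_comb x S : bimod S -> hs_form (lincomb x) S = \sum_a x a * hs_form (T a) S.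
Proof. by move=> hS; exact: (hs_form_sum hA hirr hE hw). Qed.

Lemma hs_form_comb_basis x j : hs_form (lincomb x) (T j) = x j.
Proof.
have [_ o1] := oT; rewrite hs_form_comb // (bigD1 j) //= o1 eqxx mulr1 big1 ?addr0 // => l lj.
by rewrite o1 (negPf lj) mulr0.
Qed.

Lemma hs_form_comb_E x : hs_form (lincomb x) E = x ord0.
Proof. by rewrite -[E in LHS](ocons0 E T0) hs_form_comb_basis. Qed.

Lemma basis_expand S : bimod S -> S = lincomb (fun j => hs_form S (T j)).
Proof. by move/sT. Qed.

Lemma hs_form_basis_eq0 P Q : bimod P -> bimod Q ->
  (forall j, hs_form P (T j) + hs_form Q (T j) = 0) -> forall z, P z + Q z = 0.
Proof.
move=> hP hQ PQ z; rewrite (sT hP) (sT hQ) -big_split big1 // => j _ /=.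
by rewrite -scalerDl PQ scale0r.
Qed.

Lemma bilin_form (op : (C -> C) -> (C -> C) -> C -> C) j x y :
  (forall S U, bimod S -> bimod U -> bimod (op S U)) ->
  (forall x' U, bimod U -> op (lincomb x') U = fun z => \sum_a x' a *: op (T a) U z) ->
  (forall x' S, bimod S -> op S (lincomb x') = fun z => \sum_a x' a *: op S (T a) z) ->
  bilin (\matrix_(a, b) hs_form (op (T a) (T b)) (T j)) x y =
  hs_form (op (lincomb x) (lincomb y)) (T j).
Proof.
move=> hop opl opr; have hc := bimod_comb.
rewrite opl // (hs_form_sum hA hirr hE hw) // => [|a]; last exact: hop.
apply: eq_bigr => a _; rewrite opr // (hs_form_sum hA hirr hE hw) // => [|b]; last exact: hop.
by rewrite mulr_sumr; apply: eq_bigr => b _; rewrite mxE; ring.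
Qed.

(** At S = U = F this is F o F - F: the factor hs_form U E, which is 1 for an
expectation, makes the equation homogeneous. *)
Definition idempotent_form (S U : C -> C) : C -> C := fun x => S (U x) - hs_form U E *: S x.

Definition convol_form (S U : C -> C) : C -> C := fun x => convol w S U x - btrace w U *: S x.

Lemma bimod_idempotent_form S U : bimod S -> bimod U -> bimod (idempotent_form S U).
Proof.
move=> hS hU; apply: bimodBf; last exact: bimodZf.
exact: (bimod_comp hS hU).
Qed.

Lemma bimod_convol_form S U : bimod S -> bimod U -> bimod (convol_form S U).
Proof.
move=> hS hU; apply: bimodBf; last exact: bimodZf.
exact: (bimod_convol hA hE hw).
Qed.

Lemma bilin_idempotent j x y :
  bilin (\matrix_(a, b) hs_form (idempotent_form (T a) (T b)) (T j)) x y =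
  hs_form (idempotent_form (lincomb x) (lincomb y)) (T j).
Proof.
apply: bilin_form => [|x' U hU|x' S hS]; first exact: bimod_idempotent_form.
  apply/funext => z; rewrite /idempotent_form /lincomb scaler_sumr -sumrB.
  by apply: eq_bigr => a _; rewrite scalerBr !scalerA mulrC.
apply/funext => z; rewrite /idempotent_form {1}/lincomb (bimod_sum hS) hs_form_comb //.
rewrite scaler_suml -sumrB; apply: eq_bigr => a _.
by rewrite (bimodZ hS) scalerBr scalerA.
Qed.

Lemma btrace_comb x : btrace w (lincomb x) = \sum_a x a * btrace w (T a).
Proof.
apply: (@scal_inj R C); transitivity (\sum_r w r * lincomb x (star (w r))).
  by rewrite (btraceE hA hirr hE hw (bimod_comb x)).
transitivity (\sum_a \sum_r x a *: (w r * T a (star (w r)))); last first.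
  rewrite scaler_suml; apply: eq_bigr => a _.
  by rewrite -scaler_sumr (btraceE hA hirr hE hw (hT a)) scalerA.
rewrite exchange_big; apply: eq_bigr => r _ /=.
by rewrite mulr_sumr; apply: eq_bigr => a _; rewrite scalerAr.
Qed.

Lemma bilin_convol j x y :
  bilin (\matrix_(a, b) hs_form (convol_form (T a) (T b)) (T j)) x y =
  hs_form (convol_form (lincomb x) (lincomb y)) (T j).
Proof.
apply: bilin_form => [|x' U hU|x' S hS]; first exact: bimod_convol_form.
  apply/funext => z; rewrite /convol_form /lincomb scaler_sumr.
  transitivity (\sum_a (x' a *: convol w (T a) U z - btrace w U *: (x' a *: T a z))); last first.
    by apply: eq_bigr => a _; rewrite scalerBr !scalerA mulrC.
  rewrite sumrB; congr (_ - _); rewrite [RHS](eq_bigr (fun a => \sum_r x' a *: (T a (z * w r) * U (star (w r))))).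
    rewrite exchange_big; apply: eq_bigr => r _ /=.
    by rewrite mulr_suml; apply: eq_bigr => a _; rewrite scalerAl.
  by move=> a _; rewrite scaler_sumr.
apply/funext => z; rewrite /convol_form btrace_comb.
transitivity (\sum_a (x' a *: convol w S (T a) z - (x' a * btrace w (T a)) *: S z)); last first.
  by apply: eq_bigr => a _; rewrite scalerBr !scalerA.
rewrite sumrB scaler_suml; congr (_ - _).
rewrite [RHS](eq_bigr (fun a => \sum_r x' a *: (S (z * w r) * T a (star (w r))))).
  rewrite exchange_big; apply: eq_bigr => r _ /=.
  by rewrite mulr_sumr; apply: eq_bigr => a _; rewrite scalerAr.
by move=> a _; rewrite scaler_sumr.
Qed.

(** An intermediate algebra is the fixed-point set of its expectation, so it is
determined by the coordinates of the latter; these are nondegenerate zeros of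
2 (k + 1) quadrics in k affine unknowns. *)
Lemma compatible_count N (Bf : 'I_N -> set C) : injective Bf ->
  (forall j, compatible A E (Bf j)) -> (N <= 2 ^ k)%N.
Proof.
move=> Bf_inj Bf_comp.
have /fin_all_exists[F FP] : forall j, exists F : C -> C,
    conditional_expectation (Bf j) F /\ forall x, E x = E (F x).
  by move=> j; have [] := Bf_comp j.
have hB j : cstar_subalgebra (Bf j) by have [] := Bf_comp j.
have AB j : A `<=` Bf j by have [] := Bf_comp j.
have hF j : conditional_expectation (Bf j) (F j) by have [] := FP j.
have EF j x : E x = E (F j x) by have [_] := FP j.
have bF j : bimod (F j) := bimod_expectation (hB j) (hF j) (AB j).
have phiFE j : hs_form (F j) E = 1.
  apply: (@scal_inj R C); rewrite -(hs_formE hA hirr hE hw (bF j) bE) scale1r -(condE1 (hB j) (hF j)).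
  rewrite (bimod_expand hE hw (bF j)); apply: eq_bigr => r _.
  by rewrite -(condE_star hA hE) mulr1.
pose a j i := hs_form (F j) (T i).
have Fa j : F j = lincomb (a j) by exact: basis_expand.
pose q (i : 'I_(k.+1 + k.+1)) : 'M[R[i]]_k.+1 := match fintype.split i with
  | inl l => \matrix_(b, c) hs_form (idempotent_form (T b) (T c)) (T l)
  | inr l => \matrix_(b, c) hs_form (convol_form (T b) (T c)) (T l)
  end.
have bFF j x : Bf j (F j x) by exact: condE_mem (hF j) x.
apply: (@bezout_quadrics _ k _ N q a) => [j|i j aij|i j|j v v0 vq].
- by rewrite /a ocons0.
- apply: Bf_inj; have Fij : F i = F j.
    by rewrite (Fa i) (Fa j); congr lincomb; apply/funext.
  apply/seteqP; split=> x Bx.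
    by rewrite -(condE_id (hF i) Bx) Fij.
  by rewrite -(condE_id (hF j) Bx) -Fij.
- rewrite /q; case: (fintype.split i) => l; rewrite ?bilin_idempotent ?bilin_convol -(Fa j).
    apply: (@scal_inj R C); rewrite scale0r -(hs_formE hA hirr hE hw) //; last exact: bimod_idempotent_form.
    rewrite big1 // => r _; rewrite /idempotent_form phiFE scale1r.
    by rewrite (condE_id (hF j) (bFF j _)) subrr mul0r.
  apply: (@scal_inj R C); rewrite scale0r -(hs_formE hA hirr hE hw) //; last exact: bimod_convol_form.
  rewrite big1 // => r _; rewrite /convol_form.
  by rewrite (convol_expectation hA hirr hE hfaith hw (hB j) (hF j) (AB j) (EF j)) subrr mul0r.
set V := lincomb v; have bV : bimod V by exact: bimod_comb.
have V0 : hs_form V E = 0 by rewrite hs_form_comb_E.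
suff Vz : forall x, V x = 0.
  move=> i; rewrite -(hs_form_comb_basis v i) -/V; apply: (@scal_inj R C).
  by rewrite scale0r -(hs_formE hA hirr hE hw) // big1 // => r _; rewrite Vz mul0r.
apply: (expectation_rigid hA hirr hE hfaith hw (hB j) (hF j) (AB j) (EF j) bV) => x.
  have : forall z, idempotent_form (F j) V z + idempotent_form V (F j) z = 0.
    apply: hs_form_basis_eq0; [exact: bimod_idempotent_form..|move=> l].
    have := vq (lshift k.+1 l); rewrite /q (unsplitK (inl l)) !bilin_idempotent.
    by rewrite -(Fa j).
  move/(_ x); rewrite /idempotent_form V0 phiFE scale0r scale1r subr0 addrA => /eqP.
  by rewrite subr_eq0 => /eqP.
have : forall z, convol_form (F j) V z + convol_form V (F j) z = 0.
  apply: hs_form_basis_eq0; [exact: bimod_convol_form..|move=> l].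
  have := vq (rshift k.+1 l); rewrite /q (unsplitK (inr l)) !bilin_convol.
  by rewrite -(Fa j).
move/(_ x); rewrite /convol_form addrACA -opprD => /eqP.
by rewrite subr_eq0 => /eqP.
Qed.

End Counting.

(** * The index, the commutant and the final count *)

Section Assembly.
Variables (R : realType) (C : cstarAlgType R) (A : set C) (E : C -> C).
Hypotheses (hA : cstar_subalgebra A) (hirr : irreducible A).
Hypotheses (hE : conditional_expectation A E) (hfaith : faithful E).
Variables (n : nat) (w : 'I_n -> C).
Hypothesis hw : quasi_basis_star E w.

Lemma Ind_scalar : Ind E = hs_form w id id *: 1.
Proof.
have EE := condE_mem hE.
rewrite -(hs_formE hA hirr hE hw (bimod_id A) (bimod_id A)) /Ind; apply: xget_unique.
  exists n, w, (fun r => star (w r)); split=> // x.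
  by split; [rewrite (qb_left hw)|rewrite (qb_right hA hE hw)].
move=> z [m [u [v [uv ->]]]].
transitivity (\sum_i u i * \sum_r E (v i * w r) * star (w r)).
  by apply: eq_bigr => i _; rewrite (qb_right hA hE hw).
under eq_bigr do rewrite mulr_sumr; rewrite exchange_big; apply: eq_bigr => r _ /=.
rewrite [X in _ = X * _](proj1 (uv (w r))) mulr_suml; apply: eq_bigr => i _.
by rewrite mulrA.
Qed.

Lemma inner_eq0 x : (forall y, inner E x y = 0) -> x = 0.
Proof. by move=> /(_ x); exact: hfaith. Qed.

Lemma innerDl x x' y : inner E (x + x') y = inner E x y + inner E x' y.
Proof. by rewrite /inner starD mulrDl (condED hE). Qed.

Lemma innerZl c x y : inner E (c *: x) y = Num.conj c *: inner E x y.
Proof. by rewrite /inner starZ -scalerAl (condEZ hA hE). Qed.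

Lemma inner_ext x x' : (forall y, inner E x y = inner E x' y) -> x = x'.
Proof.
move=> xx; apply/eqP; rewrite -subr_eq0; apply/eqP; apply: inner_eq0 => y.
by rewrite innerDl -[- x']scaleN1r innerZl rmorphN1 scaleN1r xx subrr.
Qed.

(** An adjointable map is linear and right A-linear because the inner product is
faithful.  Conversely T = sum_r L_(T w_r) E L_(star w_r) lies in the span itself. *)
Lemma commutant_basic_construction T :
  commutant_in_basic_construction A E T <-> bimod A T.
Proof.
have [_ _ _ Astar _] := hA; have EE := condE_mem hE.
split=> [[[[T' TT'] _] comm]|hT].
  split=> [c x y|a x Aa|a x Aa].
  - apply: inner_ext => z; rewrite innerDl innerZl !TT'.
    by rewrite innerDl innerZl.
  - by have := comm a Aa => /(congr1 (fun f => f x)).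
  - apply: inner_ext => z; rewrite TT' {1}/inner starM -mulrA.
    rewrite (condEMl hA hE _ (Astar _ Aa)) -/(inner E x (T' z)) -TT' /inner starM -mulrA.
    by rewrite (condEMl hA hE _ (Astar _ Aa)).
split; last first.
  by move=> a Aa; apply/funext => x /=; rewrite /lmul (bimodMl hT).
split.
  exists (fun y => \sum_r w r * E (star (T (w r)) * y)) => x y.
  rewrite /inner mulr_sumr (condE_sum hA hE) [T x](bimod_expand hE hw hT) star_sum.
  rewrite mulr_suml (condE_sum hA hE); apply: eq_bigr => r _.
  rewrite starM -(condE_star hA hE) starM starK -mulrA (condEMl hA hE _ (EE _)).
  by rewrite mulrA (condEMr hA hE _ (EE _)).
move=> eps eps0; exists T; last first.
  move=> z; rewrite subrr /module_norm /inner mulr0 (condE0 hA hE) cnorm0 sqrtr0.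
  by rewrite mulr_ge0 ?sqrtr_ge0 // ltW.
exists n, (fun=> 1), (fun r => lmul (T (w r)) \o E \o lmul (star (w r))); split.
  by move=> r; exists (T (w r)), (star (w r)).
apply/funext => x; rewrite [LHS](bimod_expand hE hw hT) fct_sumE.
by apply: eq_bigr => r _; rewrite scale1r.
Qed.

Lemma commutant_has_dim k (T : 'I_k -> C -> C) :
  orthonormal_maps A w T -> spanning A w T ->
  has_dim (commutant_in_basic_construction A E) k.
Proof.
move=> [hT o1] sT; exists T; split=> [c c0 j|].
  have cT x : \sum_i c i *: T i x = 0.
    by have /(congr1 (fun f => f x)) := c0; rewrite fct_sumE.
  have : hs_form w (fun x => \sum_i c i *: T i x) (T j) = 0.
    apply: (@scal_inj R C); rewrite -(hs_formE hA hirr hE hw) //; last exact: bimod_lin.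
    by rewrite scale0r big1 // => r _; rewrite cT mul0r.
  rewrite (hs_form_sum hA hirr hE hw) // (bigD1 j) //= o1 eqxx mulr1 big1 ?addr0 // => i ij.
  by rewrite o1 (negPf ij) mulr0.
apply/seteqP; split=> S.
  move=> [m [c [u [uT ->]]]]; apply/commutant_basic_construction.
  have -> : \sum_i c i *: u i = fun x => \sum_i c i *: u i x by rewrite fct_sumE.
  by apply: bimod_lin => i; have [j _ <-] := uT i.
move/commutant_basic_construction => hS; exists k, (fun j => hs_form w S (T j)), T; split.
  by move=> j; exists j.
by rewrite {1}(sT _ hS) fct_sumE.
Qed.

End Assembly.

Lemma card_le_of_families (X : choiceType) (P : set X) (K : nat) :
  (forall N (f : 'I_N -> X), injective f -> (forall j, P (f j)) -> (N <= K)%N) ->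
  exists2 N, P #= `I_N & (N <= K)%N.
Proof.
move=> bound.
have fbound (Y : {fset X}) : [set` Y] `<=` P -> (#|` Y| <= K)%N.
  move=> YP; apply: (bound _ (fun j : 'I_#|` Y| => tnth (in_tuple (enum_fset Y)) j)).
    by apply/tuple_uniqP; exact: fset_uniq.
  by move=> j; apply: YP; exact: mem_tnth.
have finP : finite_set P.
  apply: contrapT => /(infinite_set_fset K.+1)[Y YP].
  by rewrite ltnNge (fbound _ YP).
have /finite_fsetP[Y PY] := finP; exists #|` Y|; first by rewrite PY; exact/card_eq_fsetP.
by apply: fbound; rewrite PY.
Qed.

Theorem corollary10p4 (R : realType) (C : cstarAlgType R) (A : set C) (E : C -> C)
    (hA : cstar_subalgebra A) (hirr : irreducible A)
    (hE : conditional_expectation A E) (hfaith : faithful E)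
    (hfin : finite_watatani_index E) :
  (exists c : R[i], Ind E = c *: 1) /\
  (exists d N : nat,
     [/\ has_dim (commutant_in_basic_construction A E) d,
         [set B : set C | compatible A E B] #= `I_N,
         (N%:R : R) <= 2 ^ (d%:Z - 1),
         (2 : R) ^ (d%:Z - 1) <= 2 ^ (Num.floor (cnorm (Ind E)) - 1)
       & (2 : R) ^ (Num.floor (cnorm (Ind E)) - 1) < 2 `^ cnorm (Ind E)]).
Proof.
have [n [w hw]] := exists_quasi_basis_star hA hE hfin.
have IndE := Ind_scalar hA hirr hE hw.
split; first by exists (hs_form w id id).
have [k [T0 [oT sT]]] := exists_orthonormal_basis hA hirr hE hw.
have [N PN N2k] := card_le_of_families
  (fun N f => @compatible_count R C A E hA hirr hE hfaith n w hw k T0 oT sT N f).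
have lam0 := hs_form_ge0 hA hirr hE hw (bimod_id A).
have [l lE] : exists l : R, hs_form w id id = l%:c.
  by exists (complex.Re (hs_form w id id)); rewrite RRe_real // realE lam0.
have dl : k.+1%:R <= l.
  have := orthonormal_basis_card hA hirr hE hw oT sT.
  by rewrite lE -[_%:R](rmorph_nat (real_complex R)) lecR.
have normI : cnorm (Ind E) = l.
  by rewrite IndE lE cnormZr cnorm1 mulr1 ger0_norm // (le_trans _ dl).
exists k.+1, N; rewrite normI.
have kE : k.+1%:Z - 1 = k%:Z by rewrite -addn1 PoszD addrK.
have [m mE] : exists m : nat, Num.floor l = m.+1%:Z.
  have : (k.+1%:Z <= Num.floor l)%R by rewrite floor_ge_int.
  by case: (Num.floor l) => // -[|m] // _; exists m.
have mE' : m.+1%:Z - 1 = m%:Z by rewrite -addn1 PoszD addrK.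
have km : (k <= m)%N.
  have : (k.+1%:Z <= Num.floor l)%R by rewrite floor_ge_int.
  by rewrite mE.
have ml : m.+1%:R <= l by have := floor_le l; rewrite mE.
split.
- exact: (commutant_has_dim hA hirr hE hfaith hw oT sT).
- exact: PN.
- by rewrite kE -exprnP -natrX ler_nat.
- by rewrite kE mE mE' -!exprnP ler_eXn2l // ltr1n.
- rewrite mE mE' -exprnP; apply: (@lt_le_trans _ _ (2 ^+ m.+1)).
    by rewrite ltr_eXn2l // ltr1n.
  by rewrite -powR_mulrn //; apply: ler_powR => //; rewrite ler1n.
Qed.
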